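(* For $n\in\mathbb{N}$ and $1\le p\le q\le r\le\infty$ let $X_\pi^n=\ell_p^n\otimes_\pi\ell_q^n\otimes_\pi\ell_r^n$. The following hold for all $n\in\mathbb{N}$. (i) If $p=1\le q\le 2\le r$, then $$\left\|\mathrm{id}:\ell_2^{n^3}\to X_\pi^n\right\|\asymp_{q,r} n^{\min\left(\frac1q+\frac1r,\,1\right)},\qquad\text{and in particular}\qquad \mathrm{vr}(X_\pi^n)\asymp_{q,r} n^{\min\left(\frac1q-\frac12,\ \frac12-\frac1r\right)}.$$ (ii) If $p=q\le 2$ and $r=\infty$, then $$\left\|\mathrm{id}:\ell_2^{n^3}\to X_\pi^n\right\|\asymp_{p} n^{\frac1q},\qquad\text{and in particular}\qquad \mathrm{vr}(X_\pi^n)\asymp_{p} n^{\frac1q-\frac12}.$$ (iii) If $1\le p\le q=2\le r$, then $$\left\|\mathrm{id}:\ell_2^{n^3}\to X_\pi^n\right\|\asymp_{p,r} n^{\frac12+\frac1r},\qquad\text{and in particular}\qquad \mathrm{vr}(X_\pi^n)\asymp_{p,r} 1.$$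
   Context: All spaces are real and $1/\infty=0$. $\ell_p^n$ is $\mathbb{R}^n$ with the $\ell_p$-norm. The space $\ell_p^n\otimes_\pi\ell_q^n\otimes_\pi\ell_r^n$ is $\mathbb{R}^n\otimes\mathbb{R}^n\otimes\mathbb{R}^n\cong\mathbb{R}^{n^3}$ (identified via the basis $e_i\otimes e_j\otimes e_k$) with the projective norm $\|A\|_\pi=\inf\{\sum_{l=1}^m\|x_l\|_p\|y_l\|_q\|z_l\|_r: m\in\mathbb{N},\ A=\sum_{l=1}^m x_l\otimes y_l\otimes z_l\}$. $\mathrm{id}$ is the natural identity map under this identification, and $\|\cdot\|$ its operator norm. For an $N$-dimensional normed space $X$ with unit ball $B_X$, $\mathrm{vr}(X)=\left(\mathrm{vol}_N(B_X)/\mathrm{vol}_N(\mathcal{E}_X)\right)^{1/N}$, where $\mathcal{E}_X$ is the ellipsoid of maximal volume contained in $B_X$. The notation $\asymp$ with subscripts means two-sided inequality up to positive multiplicative constants depending only on the subscripted parameters (not on $n$). *)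

(* Defs.v *)
From HB Require Import structures.
From mathcomp Require Import all_boot all_order all_algebra.
From mathcomp Require Import mxtens.
From mathcomp Require Import all_classical all_reals all_analysis.
Set Implicit Arguments.
Unset Strict Implicit.
Unset Printing Implicit Defensive.
Import Order.TTheory GRing.Theory Num.Theory.
Import numFieldNormedType.Exports.
Local Open Scope classical_set_scope.
Local Open Scope ring_scope.

(* The reciprocal of an exponent in [1, +oo], with 1/oo = 0. *)
Definition rexp (R : realType) (p : \bar R) : R := fine (p^-1)%E.

(* Only used for 1 <= p <= +oo; the value at -oo is junk. *)
Definition lp_norm (R : realType) (N : nat) (p : \bar R) (x : 'rV[R]_N) : R :=
  match p with
  | s%:E => (\sum_(i < N) `|x 0 i| `^ s) `^ s^-1
  | +oo%E => \big[Num.max/0]_(i < N) `|x 0 i|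
  | -oo%E => 0
  end.

(* The normed space (R^N, ||.||) is represented by its norm, a function on
   'rV[R]_N. *)
Definition unit_ball (R : realType) (N : nat) (nX : 'rV[R]_N -> R) :
    set 'rV[R]_N :=
  [set x | nX x <= 1].

Definition op_norm (R : realType) (M N : nat) (nX : 'rV[R]_M -> R)
    (nY : 'rV[R]_N -> R) (f : 'rV[R]_M -> 'rV[R]_N) : R :=
  sup [set nY (f x) | x in unit_ball nX].

(* e_i (x) e_j (x) e_k is identified with the basis vector of R^(n * n * n)
   of index mxtens_index (mxtens_index (i, j), k). *)
Definition tensor3 (R : realType) (n : nat) (x y z : 'rV[R]_n) :
    'rV[R]_(n * n * n) :=
  tensmx (tensmx x y) z.

Definition proj_norm (R : realType) (n : nat) (p q r : \bar R)
    (A : 'rV[R]_(n * n * n)) : R :=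
  inf [set s | exists m (x y z : 'I_m -> 'rV[R]_n),
    A = \sum_(l < m) tensor3 (x l) (y l) (z l) /\
    s = \sum_(l < m)
          lp_norm p (x l) * lp_norm q (y l) * lp_norm r (z l)].

(* N-dimensional Lebesgue measure, as the iterated product of the
   one-dimensional one: the step is the formula defining the product measure
   (product_measure1) on R * R^N, with R^(N+1) split as R * R^N. *)
Fixpoint vol (R : realType) (N : nat) : set 'rV[R]_N -> \bar R :=
  match N return set 'rV[R]_N -> \bar R with
  | 0 => fun A => (\1_A 0)%:E
  | N'.+1 => fun A =>
      (\int[lebesgue_measure]_t
         vol [set v : 'rV[R]_N' | A (row_mx (t%:M : 'rV[R]_1) v)])%E
  end.

Definition is_ellipsoid (R : realType) (N : nat) (E : set 'rV[R]_N) : Prop :=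
  exists (c : 'rV[R]_N) (T : 'M[R]_N), T \in unitmx /\
    E = [set c + u *m T | u in unit_ball (lp_norm 2%:E)].

Definition is_max_vol_ellipsoid (R : realType) (N : nat)
    (B E : set 'rV[R]_N) : Prop :=
  [/\ is_ellipsoid E, E `<=` B &
      forall E', is_ellipsoid E' -> E' `<=` B -> (vol E' <= vol E)%E].

Definition max_vol_ellipsoid (R : realType) (N : nat) (B : set 'rV[R]_N) :
    set 'rV[R]_N :=
  xget set0 [set E | is_max_vol_ellipsoid B E].

Definition volume_ratio (R : realType) (N : nat) (nX : 'rV[R]_N -> R) : R :=
  (fine (vol (unit_ball nX)) /
   fine (vol (max_vol_ellipsoid (unit_ball nX)))) `^ (N%:R^-1).

(* f n and g n agree, uniformly in n >= 1, up to positive factors. *)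
Definition asymp (R : realType) (f g : nat -> R) : Prop :=
  exists c C : R, [/\ 0 < c, 0 < C &
    forall n, (0 < n)%N -> c * g n <= f n /\ f n <= C * g n].

Definition id_norm (R : realType) (p q r : \bar R) (n : nat) : R :=
  op_norm (@lp_norm R (n * n * n) 2%:E) (@proj_norm R n p q r) id.

Definition vr_proj (R : realType) (p q r : \bar R) (n : nat) : R :=
  volume_ratio (@proj_norm R n p q r).

(* Sanity check: the volume of a box is the product of its side lengths. *)
Lemma vol_box (R : realType) (N : nat) (a b : 'rV[R]_N) :
  (forall i, a 0 i <= b 0 i) ->
  vol [set x | forall i, a 0 i <= x 0 i <= b 0 i] =
  (\prod_(i < N) (b 0 i - a 0 i))%:E.
Proof.
elim: N a b => [|N IH] a b ab /=.
  by rewrite big_ord0 indicE mem_set// => -[].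
pose a' : 'rV[R]_N := \row_i a 0 (lift ord0 i).
pose b' : 'rV[R]_N := \row_i b 0 (lift ord0 i).
have IH' := IH a' b'.
under eq_integral => t _.
  have -> : vol [set v : 'rV[R]_N | forall i : 'I_N.+1,
        a 0 i <= (row_mx (t%:M : 'rV[R]_1) v : 'rV_(1 + N)) 0 i <= b 0 i] =
      ((\prod_(i < N) (b' 0 i - a' 0 i))%:E *
       (\1_(`[a 0 ord0, b 0 ord0]) t)%:E)%E.
    have e0 (v : 'rV[R]_N) :
        (row_mx (t%:M : 'rV[R]_1) v : 'rV_(1 + N)) 0 (ord0 : 'I_N.+1) = t.
      rewrite (_ : ord0 = lshift N ord0 :> 'I_(1 + N)); last exact: val_inj.
      by rewrite row_mxEl !mxE mulr1n.
    have eS (v : 'rV[R]_N) i :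
        (row_mx (t%:M : 'rV[R]_1) v : 'rV_(1 + N)) 0 (lift ord0 i : 'I_N.+1)
          = v 0 i.
      rewrite (_ : lift ord0 i = rshift 1 i :> 'I_(1 + N)); last exact: val_inj.
      by rewrite row_mxEr.
    rewrite indicE; have [tin|tout] := boolP (t \in _).
      rewrite mule1 -IH'; last by move=> i; rewrite !mxE.
      congr vol; apply/seteqP; split=> v /= h i.
        by have := h (lift ord0 i); rewrite eS !mxE.
      case: (unliftP ord0 i) => [j ->|->]; first by have := h j; rewrite eS !mxE.
      by rewrite e0; move: tin; rewrite inE /= in_itv.
    rewrite mule0 (_ : [set _ | _] = set0).
      by clear; elim: N => [|N IH] /=; [rewrite indicE in_set0|
        under eq_integral => s _ do rewrite IH; rewrite integral0].
    apply/seteqP; split=> v //= /(_ ord0); rewrite e0 => h.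
    by move/negP: tout; apply; rewrite inE /= in_itv.
  over.
rewrite integralZl//=; last first.
  by apply/integrable_indic_itv.
rewrite integral_indic// setIT.
rewrite [X in (_ * X)%E](_ : _ = (b 0 ord0 - a 0 ord0)%:E).
  rewrite big_ord_recl EFinM muleC; congr (_ * _)%E.
  by congr EFin; apply: eq_bigr => i _; rewrite !mxE.
have := lebesgue_measure_itv `[a 0 ord0, b 0 ord0].
rewrite /= lte_fin => ->.
have := ab ord0; rewrite le_eqVlt => /predU1P[->|->]; last by rewrite EFinB.
by rewrite ltxx subrr.
Qed.

(* Main.v *)
(* Put N = n^3, let B be the unit ball of the projective norm and rho the norm
   of the identity; all cases have p <= q <= 2 <= r.

   Volume ratio.  The symmetries of B (signs and cyclic shifts in each factor)
   act irreducibly, so the ellipsoid of maximal volume is the Euclidean ball of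
   radius 1/rho: write an ellipsoid as the image of the Euclidean ball under a
   triangular matrix L (QR), average the conjugates of L over the symmetries to
   get the scalar tr L / N, and apply AM-GM.  Moreover vol(B)^(1/N) is of order
   n^(-2-1/r).  From below, B contains the cube of half-side n^(-2-1/r).  From
   above, B is covered by few small balls: by Maurey's empirical method, run
   over products of lattice nets of size C^n, a point of B is close to an
   average of n^2 elementary tensors.  Hence the volume ratio is of order
   rho n^(-1/2-1/r) in all cases.

   Norm of the identity.  From above, averaging over signs e the tensors
   e_i (x) (A_i e) (x) e gives n^(1/q+1/r), and the rows of A give n.  From
   below: in (i), the tensor sum_ij e_i (x) e_j (x) e_j and Hoelder's inequality;
   in (iii), the volume estimate, since the ball of radius 1/rho lies in B; in
   (ii), the same volume argument in the slice R^n (x) R^n (x) e_0, with the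
   empirical method run in l_q, which has type q. *)

From HB Require Import structures.
Require Import Defs.
From mathcomp Require Import all_boot all_order all_algebra.
From mathcomp Require Import mxtens.
From mathcomp Require Import all_classical all_reals all_analysis.
From mathcomp Require Import measurable_realfun zify ring lra.
Set Implicit Arguments.
Unset Strict Implicit.
Unset Printing Implicit Defensive.
Import Order.TTheory GRing.Theory Num.Theory.
Import numFieldNormedType.Exports.
Local Open Scope classical_set_scope.
Local Open Scope ring_scope.

(** * Volumes as iterated integrals *)

(** The volume is a bare iterated integral, and Fubini would require measurability of every slice.
    To avoid this, only facts valid for arbitrary sets are used: monotonicity, the effect of
    triangular maps, and one covering bound, in which the indicator of a union of l_1 balls is
    replaced by a sum of exponentials whose integral factors over the coordinates. Triangular maps
    suffice because the orthogonal factor of an ellipsoid is absorbed by the Euclidean ball. The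
    number n^2 of samples balances two effects. The centres number C^(n * n^2), so their count costs
    a constant after the N-th root; and an average of n^2 vectors has l_2 error of order n^(-1),
    hence n^(-1) N^(-1/2) = n^(-5/2) per coordinate. Fitting the l_r factor into an l_2 ball loses
    n^(1/2-1/r), which gives n^(-2-1/r). *)

Section volume.
Context {R : realType}.
Local Notation mu := (@lebesgue_measure R).
Import HBNNSimple.

(* The integral of a nonnegative function is a supremum over simple functions
   even when the function is not measurable, so that [vol] can be handled on
   arbitrary sets. *)
Lemma ge0_le_integral_nonmeasurable (f g : R -> \bar R) :
  (forall x, 0 <= f x)%E -> (forall x, f x <= g x)%E ->
  (\int[mu]_x f x <= \int[mu]_x g x)%E.
Proof.
move=> f0 fg.
have g0 x : (0 <= g x)%E by exact: le_trans (f0 x) (fg x).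
rewrite !ge0_integralTE//; apply: ereal_sup_le => _ [h /= hf <-].
by exists h => // x; exact: le_trans (hf x) (fg x).
Qed.

Lemma measurable_affine (a b : R) :
  measurable_fun setT (fun t : measurableTypeR R => a * t + b : measurableTypeR R).
Proof.
apply: measurable_funD => //.
Qed.

(** The right-hand side is again a measure in A, and it agrees with Lebesgue measure on half-open
    intervals. *)
Lemma lebesgue_measure_affine (a b : R) (A : set (measurableTypeR R)) :
  0 < a -> measurable A ->
  (mu A = a%:E * pushforward mu (fun t : measurableTypeR R => a * t + b : measurableTypeR R)%R A)%E.
Proof.
move=> a0 mA.
pose nu := mscale (NngNum (ltW a0))
  (measure_function_pushforward__canonical__measure_function_Measure mu (measurable_affine a b)).
suff -> : mu A = nu A by [].
apply: lebesgue_measure_unique => //= _ [[x y] _ <-].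
rewrite /nu /mscale/= /pushforward.
have -> : (fun t : measurableTypeR R => a * t + b : measurableTypeR R) @^-1` `]x, y] =
   `](x - b) / a, (y - b) / a]%classic.
  apply/seteqP; split=> t /=; rewrite !in_itv/= => /andP[h1 h2]; apply/andP; split.
  - by rewrite ltr_pdivrMr// ltrBlDr mulrC.
  - by rewrite ler_pdivlMr// lerBrDr mulrC.
  - by move: h1; rewrite ltr_pdivrMr// ltrBlDr mulrC.
  - by move: h2; rewrite ler_pdivlMr// lerBrDr mulrC.
rewrite !lebesgue_measure_itv/= !lte_fin ltr_pM2r ?invr_gt0// ltrD2r.
case: ifP => _; last by rewrite mule0.
rewrite -!EFinB -EFinM; congr (_%:E); field; lra.
Qed.

(** Change of variables without measurability of f: it is applied to each simple function below f,
    which yields one inequality. The converse is the same inequality for the inverse map. *)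
Lemma integral_affine_le (f : R -> \bar R) (a b : R) : 0 < a ->
  (forall x, 0 <= f x)%E ->
  (\int[mu]_x f x <= a%:E * \int[mu]_x f (a * x + b)%R)%E.
Proof.
move=> a0 f0.
rewrite [leLHS]ge0_integralTE//; apply: ge_ereal_sup => _ [h /= hf <-].
pose nu := mscale (NngNum (ltW a0))
  (measure_function_pushforward__canonical__measure_function_Measure mu (measurable_affine a b)).
have -> : sintegral mu h = (\int[mu]_x (h x)%:E)%E.
  by rewrite integral_nnsfun// patch_setT.
have -> : (\int[mu]_x (h x)%:E = \int[nu]_x (h x)%:E)%E.
  apply: eq_measure_integral => A mA _ /=; exact: (lebesgue_measure_affine b a0 mA).
rewrite ge0_integral_mscale//=; last 2 first.
  by apply/measurable_EFinP.
  by move=> x _; rewrite lee_fin.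
rewrite ge0_integral_pushforward//=; last 3 first.
  exact: measurable_affine.
  by apply/measurable_EFinP.
  by move=> x _; rewrite lee_fin.
rewrite lee_pmul2l//; rewrite preimage_setT.
apply: ge0_le_integral_nonmeasurable => x; last exact: hf.
by rewrite lee_fin.
Qed.

Lemma integral_affine (f : R -> \bar R) (a c : R) : 0 < a ->
  (forall x, 0 <= f x)%E ->
  (\int[mu]_x f ((x - c) / a)%R = a%:E * \int[mu]_x f x)%E.
Proof.
move=> a0 f0; apply/eqP; rewrite eq_le; apply/andP; split.
  apply: (le_trans (integral_affine_le c a0 _)) => [x|]; first exact: f0.
  under [in leLHS]eq_integral => x _ do rewrite addrK mulrC mulKf ?gt_eqF//.
  by [].
rewrite -[leRHS]mul1e -(divff (lt0r_neq0 a0)) EFinM -muleA.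
rewrite lee_pmul2l//.
have ia0 : 0 < a^-1 by rewrite invr_gt0.
have := integral_affine_le (- c / a) ia0 f0.
by under [in leRHS]eq_integral => x _ do rewrite mulrC -mulrDl.
Qed.



(** Linearity is applied to simple functions only: division by k turns one below k f into one below
    f. *)
Lemma integral_scale_le (f : R -> \bar R) (k : R) : 0 < k ->
  (forall x, 0 <= f x)%E ->
  (\int[mu]_x (k%:E * f x) <= k%:E * \int[mu]_x f x)%E.
Proof.
move=> k0 f0; rewrite [leLHS]ge0_integralTE//; last first.
  by move=> x; rewrite mule_ge0// lee_fin ltW.
apply: ge_ereal_sup => _ [h /= hf <-].
have -> : sintegral mu h = (\int[mu]_x (h x)%:E)%E.
  by rewrite integral_nnsfun// patch_setT.
have ik0 : 0 < k^-1 by rewrite invr_gt0.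
rewrite -[leLHS]mul1e -(divff (lt0r_neq0 k0)) EFinM -muleA lee_pmul2l//.
rewrite -ge0_integralZl_EFin//=; last 3 first.
  by move=> x _; rewrite lee_fin.
  by apply/measurable_EFinP.
  exact: ltW.
apply: ge0_le_integral_nonmeasurable => x; first by rewrite -EFinM lee_fin mulr_ge0// ltW.
rewrite -[leRHS]mul1e -(mulVf (lt0r_neq0 k0)) EFinM -muleA.
by rewrite lee_pmul2l.
Qed.

Lemma integral_scale (f : R -> \bar R) (k : R) : 0 < k ->
  (forall x, 0 <= f x)%E ->
  (\int[mu]_x (k%:E * f x) = k%:E * \int[mu]_x f x)%E.
Proof.
move=> k0 f0; apply/eqP; rewrite eq_le integral_scale_le//=.
have ik0 : 0 < k^-1 by rewrite invr_gt0.
have kf0 x : (0 <= k%:E * f x)%E by rewrite mule_ge0// lee_fin ltW.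
have := integral_scale_le ik0 kf0.
under eq_integral => x _ do
  rewrite muleA -EFinM mulVf ?lt0r_neq0// mul1e.
move=> h; rewrite -[leRHS]mul1e -(divff (lt0r_neq0 k0)) EFinM -muleA.
by rewrite lee_pmul2l.
Qed.

Lemma vol_ge0 N (A : set 'rV[R]_N) : (0 <= vol A)%E.
Proof.
elim: N A => [|N IH] A /=; first by rewrite lee_fin indicE.
by apply: integral_ge0 => t _; exact: IH.
Qed.

Lemma vol_le N (A B : set 'rV[R]_N) : A `<=` B -> (vol A <= vol B)%E.
Proof.
elim: N A B => [|N IH] A B AB /=.
  rewrite lee_fin !indicE ler_nat.
  by case: (boolP (0 \in A)) => // /set_mem /AB /mem_set ->.
by apply: ge0_le_integral_nonmeasurable => t; [exact: vol_ge0|apply: IH => v; exact: AB].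
Qed.

(** The first coordinate of u L depends on the first coordinate of u alone. Hence a slice of the
    image is, up to a translation depending on the height, the image of a slice of A under the lower
    right block, and the induction is a one-dimensional change of variables. *)
Lemma vol_triangular N (c : 'rV[R]_N) (L : 'M[R]_N) (A : set 'rV[R]_N) :
  (forall i j : 'I_N, (j < i)%N -> L i j = 0) -> (forall i, 0 < L i i) ->
  vol [set c + u *m L | u in A] = ((\prod_i L i i)%:E * vol A)%E.
Proof.
elim: N c L A => [|N IH] c L A L0 Lp /=.
  rewrite big_ord0 mul1e; congr (_%:E); rewrite !indicE; congr (nat_of_bool _)%:R.
  apply/idP/idP => /set_mem h; apply/mem_set.
    by case: h => u; rewrite [u]thinmx0.
  by exists 0 => //; exact: thinmx0.
pose L1 : 'M[R]_(1 + N) := L.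
pose a := L ord0 ord0; pose L' := drsubmx L1; pose w := ursubmx L1.
pose c1 : 'rV[R]_(1 + N) := c.
pose c0 := c ord0 ord0; pose c' := rsubmx c1.
have lift1 (i : 'I_N) : rshift 1 i = lift ord0 i by exact: val_inj.
have lift0 : lshift N (ord0 : 'I_1) = ord0 by exact: val_inj.
have eL : L1 = block_mx (a%:M : 'M[R]_1) w 0 L'.
  rewrite -[LHS]submxK; congr block_mx; apply/matrixP => i j.
    by rewrite !ord1 !mxE lift0 eqxx mulr1n.
  by rewrite !mxE; apply: L0; rewrite !ord1 lift1.
have ec : c1 = row_mx (c0%:M : 'M[R]_1) c'.
  rewrite -[LHS]hsubmxK; congr row_mx; apply/matrixP => i j.
  by rewrite !ord1 !mxE lift0 eqxx mulr1n.
have a0 : 0 < a by exact: Lp.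
have key s (u : 'rV[R]_N) : c1 + row_mx (s%:M : 'rV[R]_1) u *m L1 =
    row_mx ((c0 + s * a)%:M : 'rV[R]_1) (c' + s *: w + u *m L').
  rewrite eL ec mul_row_block add_row_mx mulmx0 addr0.
  by rewrite -scalar_mxM -raddfD/= mul_scalar_mx addrA.
have slice t : [set v : 'rV[R]_N |
    [set c + u *m L | u in A] (row_mx (t%:M : 'rV[R]_1) v)] =
    [set (c' + ((t - c0) / a) *: w) + u *m L' | u in
      [set v | A (row_mx (((t - c0) / a)%:M : 'rV[R]_1) v)]].
  apply/seteqP; split=> v /=.
    case=> u Au.
    pose u1 : 'rV[R]_(1 + N) := u.
    have eu : u1 = row_mx ((u ord0 ord0)%:M : 'M[R]_1) (rsubmx u1).
      rewrite -[LHS]hsubmxK; congr row_mx; apply/matrixP => i j.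
      by rewrite !ord1 !mxE lift0 eqxx mulr1n.
    have := key (u ord0 ord0) (rsubmx u1); rewrite -eu => {}key.
    move=> /(etrans (esym key)) /eq_row_mx[] /matrixP/(_ ord0 ord0).
    rewrite !mxE eqxx !mulr1n => tE <-.
    have -> : (t - c0) / a = u ord0 ord0 by rewrite -tE; field; exact: lt0r_neq0.
    by exists (rsubmx u1) => //; rewrite -eu.
  case=> u Au <-; exists (row_mx (((t - c0) / a)%:M : 'rV[R]_1) u) => //.
  apply: etrans (key _ _) _; congr (row_mx _%:M _).
  by field; exact: lt0r_neq0.
under eq_integral => t _.
  rewrite slice IH; first over.
    move=> i j ij; rewrite !mxE; apply: L0.
    by rewrite !lift1 !fintype.lift0 ltnS.
  by move=> i; rewrite !mxE lift1.
have L'p : 0 < \prod_i L' i i.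
  by apply: prodr_gt0 => i _; rewrite !mxE lift1.
rewrite integral_scale//; last by move=> x; exact: vol_ge0.
rewrite (integral_affine (f := fun s =>
  vol [set v | A (row_mx (s%:M : 'rV[R]_1) v)]))//; last first.
  by move=> x; exact: vol_ge0.
rewrite muleA -EFinM big_ord_recl mulrC; congr ((_ * _)%:E * _)%E.
by apply: eq_bigr => i _; rewrite !mxE lift1.
Qed.



(** Twice the integral over the half-line, where the integrand is the exponential density of rate
    1. *)
Lemma integral_expR_abs : (\int[mu]_t (expR (- `|t|))%:E = 2%:E)%E.
Proof.
rewrite (@ge0_symfun_integralT R (fun t => expR (- `|t|))).
- rewrite -[RHS]mule1; congr (_ * _)%E.
  rewrite -(integral_exponential_pdf (@ltr01 R)) integral_mkcond.
  apply: eq_integral => t _; rewrite patchE.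
  case: ifPn => [/set_mem /= t0|/negP t0].
    by rewrite exponential_pdfE// ger0_norm// mul1r mulN1r.
  rewrite lt0_exponential_pdf// ltNge; apply/negP => t0'; apply: t0.
  exact/mem_set.
- by move=> t; exact: expR_ge0.
- move=> t; apply: continuous_comp; last exact: continuous_expR.
  by apply: continuousN; exact: norm_continuous.
- by move=> t /=; rewrite normrN.
Qed.

Lemma integral_expR_scaled (a c : R) : 0 < a ->
  (\int[mu]_t (expR (- (a * `|t - c|)))%:E = (2 / a)%:E)%E.
Proof.
move=> a0; have ia0 : 0 < a^-1 by rewrite invr_gt0.
have := @integral_affine (fun t => (expR (- `|t|))%:E) a^-1 c ia0.
rewrite integral_expR_abs -EFinM [a^-1 * _]mulrC => <-; last first.
  by move=> x; rewrite lee_fin expR_ge0.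
apply: eq_integral => t _.
by rewrite invrK normrM (gtr0_norm a0) mulrC.
Qed.

Lemma measurable_expR_abs (a c : R) : measurable_fun setT
  (fun t : measurableTypeR R => (expR (- (a * `|(t : R) - c|)))%:E).
Proof.
apply/measurable_EFinP; apply: measurableT_comp => //.
apply: measurableT_comp => //; apply: measurable_funM => //.
by apply: measurableT_comp => //; exact: measurable_funB.
Qed.

Lemma row_mx_scalar_head N (t : R) (v : 'rV[R]_N) :
  (row_mx (t%:M : 'rV[R]_1) v : 'rV[R]_N.+1) 0 ord0 = t.
Proof.
have -> : (ord0 : 'I_N.+1) = lshift N (ord0 : 'I_1) by exact: val_inj.
by rewrite [LHS]row_mxEl !mxE mulr1n.
Qed.

Lemma row_mx_scalar_tail N (t : R) (v : 'rV[R]_N) (j : 'I_N) :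
  (row_mx (t%:M : 'rV[R]_1) v : 'rV[R]_N.+1) 0 (lift ord0 j) = v 0 j.
Proof.
have -> : lift ord0 j = rshift 1 j by exact: val_inj.
exact: row_mxEr.
Qed.

(* Covers [A] by l1 balls in a form that is stable under slicing. *)
Lemma vol_l1_mixture N (a : R) (I : finType) (w : I -> R)
    (c : I -> 'rV[R]_N) (A : set 'rV[R]_N) : 0 < a ->
  (forall x, A x ->
    1 <= \sum_i expR (w i - a * \sum_j `|x 0 j - c i 0 j|)) ->
  (vol A <= ((\sum_i expR (w i)) * (2 / a) ^+ N)%:E)%E.
Proof.
move=> a0; elim: N w c A => [|N IH] w c A HA /=.
  rewrite expr0 mulr1 lee_fin indicE.
  have s0 : 0 <= \sum_i expR (w i) by apply: sumr_ge0 => i _; exact: expR_ge0.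
  case: (boolP (0 \in A)) => // /set_mem /HA /le_trans; apply.
  by apply: ler_sum => i _; rewrite big_ord0 mulr0 subr0.
pose f (i : I) (t : R) : \bar R := ((expR (w i) * (2 / a) ^+ N)%:E *
  (expR (- (a * `|t - c i 0 ord0|)))%:E)%E.
have c0 i : 0 <= expR (w i) * (2 / a) ^+ N.
  by rewrite mulr_ge0 ?expR_ge0// exprn_ge0// divr_ge0// ltW.
have f0 i t : (0 <= f i t)%E by rewrite /f -EFinM lee_fin mulr_ge0// expR_ge0.
apply: (@le_trans _ _ (\int[mu]_t \sum_i f i t)%E).
  apply: ge0_le_integral_nonmeasurable => t; first exact: vol_ge0.
  pose c' i : 'rV[R]_N := \row_j c i 0 (lift ord0 j).
  (* The distance in the first coordinate is absorbed into the weight, so the slice satisfies the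
     hypothesis in the same form. *)
  pose w' i := w i - a * `|t - c i 0 ord0|.
  apply: le_trans (IH w' c' _ _) _ => [v /= Av|].
    apply: le_trans (HA _ Av) _; rewrite le_eqVlt; apply/orP; left; apply/eqP.
    apply: eq_bigr => i _; congr expR.
    rewrite big_ord_recl mulrDr opprD addrA /w'; congr (_ - a * `|_ - _| - a * _).
      exact: row_mx_scalar_head.
    apply: eq_bigr => j _; rewrite [c' i 0 j]mxE; congr (`|_ - _|).
    exact: row_mx_scalar_tail.
  rewrite mulr_suml -sumEFin; apply: lee_sum => i _.
  by rewrite /f -EFinM lee_fin /w' expRD mulrAC.
rewrite ge0_integral_sum//; last first.
  move=> i; apply: measurable_funeM; exact: measurable_expR_abs.
rewrite mulr_suml -sumEFin; apply: lee_sum => i _.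
rewrite ge0_integralZl_EFin//=; last 1 first.
  exact: measurable_expR_abs.
by rewrite integral_expR_scaled// -EFinM exprSr -[leLHS]/((_ * _ * _)%:E) -mulrA.
Qed.

End volume.

(** * Norms of l_p^n *)

Section lp.
Context {R : realType}.
Implicit Types (p q r : \bar R) (N : nat).

(** Three weights, because Hoelder's inequality for non-conjugate exponents needs the uniform weight
    1/N as a third factor. *)
Lemma weighted_amgm (u v w a b c : R) : 0 <= u -> 0 <= v -> 0 <= w ->
  0 <= a -> 0 <= b -> 0 <= c -> a + b + c = 1 ->
  u `^ a * v `^ b * w `^ c <= a * u + b * v + c * w.
Proof.
(* A vanishing base with exponent 0 contributes [0 `^ 0 = 1]; such a base may
   be replaced by 1. *)
have pos (x s : R) : 0 <= x -> 0 <= s -> (x `^ s = 0) \/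
    exists y, [/\ 0 < y, x `^ s = y `^ s & s * x = s * y].
  rewrite le_eqVlt => /predU1P[<-|x0] s0; last by right; exists x.
  have [->|sn0] := eqVneq s 0.
    by right; exists 1; rewrite !powRr0 !mul0r.
  by left; rewrite powR0.
move=> u0 v0 w0 a0 b0 c0 abc.
have r0 : 0 <= a * u + b * v + c * w by rewrite !addr_ge0// mulr_ge0.
case: (pos u a u0 a0) => [->|[u' [u'0 -> eu]]]; first by rewrite !mul0r.
case: (pos v b v0 b0) => [->|[v' [v'0 -> ev]]]; first by rewrite mulr0 mul0r.
case: (pos w c w0 c0) => [->|[w' [w'0 -> ew]]]; first by rewrite mulr0.
rewrite {}eu {}ev {}ew in r0 *.
have m0 : 0 < a * u' + b * v' + c * w'.
  rewrite lt_neqAle r0 andbT eq_sym; apply/eqP => m0.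
  have [h1 h2 h3] : [/\ a * u' = 0, b * v' = 0 & c * w' = 0].
    have := mulr_ge0 a0 (ltW u'0); have := mulr_ge0 b0 (ltW v'0).
    by have := mulr_ge0 c0 (ltW w'0); split; lra.
  move: h1 h2 h3 => /eqP + /eqP + /eqP; rewrite !mulf_eq0.
  rewrite !(gt_eqF u'0, gt_eqF v'0, gt_eqF w'0) !orbF => /eqP h1 /eqP h2 /eqP h3.
  lra.
set m := _ + c * w' in m0 *.
(* The tangent of the logarithm at the weighted mean m; averaging the right-hand sides with weights
   a, b, c gives ln m exactly. *)
have lnle x : 0 < x -> ln x <= ln m + (x / m - 1).
  move=> x0; have xm : 0 < x / m by rewrite divr_gt0.
  have -> : ln x = ln m + ln (x / m) by rewrite ln_div ?posrE// addrC subrK.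
  rewrite lerD2l -{1}[x / m](subrK 1) addrC le_ln1Dx//; lra.
rewrite /powR !gt_eqF// -!expRD -(lnK m0) ler_expR.
apply: (@le_trans _ _ (a * (ln m + (u' / m - 1)) + b * (ln m + (v' / m - 1)) +
  c * (ln m + (w' / m - 1)))).
  by rewrite !lerD// ler_wpM2l// lnle.
rewrite le_eqVlt; apply/orP; left; apply/eqP.
transitivity ((a + b + c) * ln m + (m / m - (a + b + c))).
  have -> : m / m = (a * u' + b * v' + c * w') / m by [].
  by clearbody m; field; exact: lt0r_neq0.
by rewrite abc mul1r divff ?lt0r_neq0// subrr addr0.
Qed.

Lemma rexp_ge1 p : (1%:E <= p)%E ->
  (exists2 s, p = s%:E & 1 <= s) \/ p = +oo%E.
Proof. by case: p => [s||]//; [left; exists s|right]. Qed.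

Lemma rexpE (s : R) : 1 <= s -> rexp s%:E = s^-1.
Proof.
move=> s1; have s0 : 0 < s by lra.
by rewrite /rexp inver gt_eqF.
Qed.

Lemma rexp_oo : rexp (+oo%E : \bar R) = 0.
Proof. by rewrite /rexp invey. Qed.

Lemma rexp_ge0 p : (1%:E <= p)%E -> 0 <= rexp p.
Proof.
case/rexp_ge1 => [[s -> s1]|->]; last by rewrite rexp_oo.
by rewrite rexpE// invr_ge0; lra.
Qed.

Lemma rexp_le1 p : (1%:E <= p)%E -> rexp p <= 1.
Proof.
case/rexp_ge1 => [[s -> s1]|->]; last by rewrite rexp_oo.
by rewrite rexpE// invf_le1//; lra.
Qed.

Lemma rexp_antitone p q : (1%:E <= p)%E -> (p <= q)%E -> rexp q <= rexp p.
Proof.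
move=> p1 pq; have q1 : (1%:E <= q)%E by exact: le_trans pq.
case/rexp_ge1: (q1) => [[t qE t1]|->]; last by rewrite rexp_oo rexp_ge0.
case/rexp_ge1: p1 pq => [[s -> s1]|->]; rewrite qE// lee_fin => st.
by rewrite !rexpE// lef_pV2// posrE; lra.
Qed.

Lemma lp_norm_ge0 N p (x : 'rV[R]_N) : 0 <= lp_norm p x.
Proof.
case: p => [s||]//=; first exact: powR_ge0.
by elim/big_ind: _ => // a b a0 b0; rewrite le_max a0.
Qed.

Lemma ler_lp_norm N p (x : 'rV[R]_N) i : (1%:E <= p)%E ->
  `|x 0 i| <= lp_norm p x.
Proof.
case/rexp_ge1 => [[s -> s1]|->] /=; last by rewrite (bigD1 i)//= le_max lexx.
have s0 : 0 < s by lra.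
rewrite -[leLHS](powRr1 (normr_ge0 _)) -(divff (lt0r_neq0 s0)) powRrM.
apply: ge0_ler_powR; rewrite ?nnegrE ?powR_ge0//.
- by rewrite invr_ge0 ltW.
- by apply: sumr_ge0 => j _; exact: powR_ge0.
rewrite (bigD1 i)//= lerDl; apply: sumr_ge0 => j _; exact: powR_ge0.
Qed.

Lemma lp_norm_eq0 N (p : \bar R) (x : 'rV[R]_N) : (1%:E <= p)%E ->
  lp_norm p x = 0 -> x = 0.
Proof.
move=> p1 x0; apply/rowP => i; apply/eqP; rewrite mxE -normr_le0 -x0.
exact: ler_lp_norm.
Qed.

Lemma lp_normZ N p (a : R) (x : 'rV[R]_N) : (1%:E <= p)%E ->
  lp_norm p (a *: x) = `|a| * lp_norm p x.
Proof.
case/rexp_ge1 => [[s -> s1]|->] /=.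
  have s0 : 0 < s by lra.
  under eq_bigr do rewrite mxE normrM powRM//.
  rewrite -mulr_sumr powRM ?powR_ge0//; last first.
    by apply: sumr_ge0 => i _; exact: powR_ge0.
  by rewrite -powRrM divff ?lt0r_neq0// powRr1.
under eq_bigr do rewrite mxE normrM.
elim/big_ind2: _ => [|u v w t -> ->|//]; first by rewrite mulr0.
by rewrite maxr_pMr.
Qed.

Lemma lp_norm_perm N p (x y : 'rV[R]_N) (s : 'I_N -> 'I_N) : injective s ->
  (forall i, `|y 0 i| = `|x 0 (s i)|) -> lp_norm p y = lp_norm p x.
Proof.
move=> sI yx; case: p => [t||]; rewrite [LHS]/lp_norm [RHS]/lp_norm; last by [].
  rewrite [in RHS](reindex_inj sI); congr (_ `^ _).
  by apply: eq_bigr => i _; rewrite yx.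
by rewrite [in RHS](reindex_inj sI); apply: eq_bigr => i _; rewrite yx.
Qed.

Lemma lp_norm_delta N p (i : 'I_N) : (1%:E <= p)%E ->
  lp_norm p (delta_mx 0 i : 'rV[R]_N) = 1.
Proof.
case/rexp_ge1 => [[s -> s1]|->] /=.
  have s0 : s != 0 by lra.
  rewrite (bigD1 i)//= big1 => [|j ji]; last first.
    by rewrite mxE (negbTE ji) andbF normr0 powR0.
  by rewrite mxE !eqxx normr1 powR1 addr0 powR1.
apply/eqP; rewrite eq_le; apply/andP; split.
  elim/big_ind: _ => // [a b a1 b1|j _]; first by rewrite ge_max a1.
  by rewrite mxE; case: (_ && _); rewrite ?normr1 ?normr0.
by rewrite (bigD1 i)//= mxE !eqxx normr1 le_max lexx.
Qed.

Lemma lp_norm2_sqr N (x : 'rV[R]_N) : lp_norm 2%:E x ^+ 2 = \sum_i x 0 i ^+ 2.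
Proof.
have s0 : 0 <= \sum_i `|x 0 i| `^ 2 by apply: sumr_ge0 => i _; exact: powR_ge0.
rewrite /= powR12_sqrt// sqr_sqrtr//.
by apply: eq_bigr => i _; rewrite powR_mulrn// real_normK// num_real.
Qed.

(* This form of the unit ball covers finite exponents and +oo uniformly. *)
Lemma lp_ballP N p (x : 'rV[R]_N) : (1%:E <= p)%E ->
  lp_norm p x <= 1 <-> exists u : 'I_N -> R,
    [/\ forall i, 0 <= u i, \sum_i u i <= 1 &
        forall i, `|x 0 i| <= u i `^ rexp p].
Proof.
case/rexp_ge1 => [[s -> s1]|->].
  have s0 : 0 < s by lra.
  rewrite rexpE//; split => [x1|[u [u0 u1 xu]]].
    exists (fun i => `|x 0 i| `^ s); split=> [i||i]; first exact: powR_ge0.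
      rewrite -[leLHS]powRr1; last by apply: sumr_ge0 => i _; exact: powR_ge0.
      rewrite -[in leLHS](mulVf (lt0r_neq0 s0)) powRrM.
      rewrite [leRHS](_ : 1 = 1 `^ s); last by rewrite powR1.
      apply: ge0_ler_powR => //; rewrite ?nnegrE ?powR_ge0//; exact: ltW.
    by rewrite -powRrM divff ?lt0r_neq0// powRr1.
  rewrite /= [leRHS](_ : 1 = 1 `^ s^-1); last by rewrite powR1.
  apply: ge0_ler_powR; rewrite ?nnegrE//.
  - by rewrite invr_ge0 ltW.
  - by apply: sumr_ge0 => i _; exact: powR_ge0.
  apply: le_trans u1; apply: ler_sum => i _.
  rewrite -[leRHS](powRr1 (u0 i)) -(mulVf (lt0r_neq0 s0)) powRrM.
  by apply: ge0_ler_powR; rewrite ?nnegrE ?powR_ge0//; exact: ltW.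
rewrite rexp_oo; split => [x1|[u [u0 u1 xu]]].
  (* Zero weights suffice: any base to the exponent 0, including 0, gives 1. *)
  exists (fun=> 0); split=> [//||i]; first by rewrite big1.
  by rewrite powRr0; apply: le_trans x1; apply: ler_lp_norm; rewrite leey.
rewrite /=; elim/big_ind: _ => // [a b a1 b1|i _]; first by rewrite ge_max a1.
by apply: le_trans (xu i) _; rewrite powRr0.
Qed.

(** Reduces a comparison of norms to unit balls, where [lp_ballP] applies. *)
Lemma lp_norm_le_scale N p q (x : 'rV[R]_N) (C : R) :
  (1%:E <= p)%E -> (1%:E <= q)%E -> 0 <= C ->
  (forall y : 'rV[R]_N, lp_norm q y <= 1 -> lp_norm p y <= C) ->
  lp_norm p x <= C * lp_norm q x.
Proof.
move=> p1 q1 C0 h; have := lp_norm_ge0 q x.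
rewrite le_eqVlt => /predU1P[/esym x0|x0].
  have -> : x = 0 by exact: lp_norm_eq0 x0.
  by rewrite -[0 in leLHS](scale0r 0) lp_normZ// normr0 mul0r mulr_ge0// lp_norm_ge0.
have ix0 : 0 < (lp_norm q x)^-1 by rewrite invr_gt0.
have := h ((lp_norm q x)^-1 *: x); rewrite !lp_normZ// gtr0_norm//.
by rewrite mulVf ?lt0r_neq0// => /(_ (lexx _)); rewrite mulrC ler_pdivrMr.
Qed.

Lemma powR_le_exp (u a b : R) : 0 <= u <= 1 -> 0 <= b -> b <= a ->
  u `^ a <= u `^ b.
Proof.
case/andP; rewrite le_eqVlt => /predU1P[<-|u0] u1 b0 ba.
  have [a0|an0] := eqVneq a 0; last by rewrite powR0// powR_ge0.
  by have -> : b = a by lra.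
by apply: ger_powR; rewrite ?u0.
Qed.

Lemma sum_le1_le1 N (u : 'I_N -> R) i : (forall j, 0 <= u j) ->
  \sum_j u j <= 1 -> 0 <= u i <= 1.
Proof.
move=> u0; rewrite (bigD1 i)//= u0 => /(le_trans _); apply.
by rewrite lerDl sumr_ge0.
Qed.

(** The weights witnessing the l_p ball also witness the l_q ball, since they are at most 1 and the
    exponent 1/q is smaller. *)
Lemma lp_norm_antitone N p q (x : 'rV[R]_N) : (1%:E <= p)%E -> (p <= q)%E ->
  lp_norm q x <= lp_norm p x.
Proof.
move=> p1 pq; have q1 : (1%:E <= q)%E by exact: le_trans pq.
rewrite -[leRHS]mul1r; apply: lp_norm_le_scale => // y /lp_ballP-/(_ p1).
case=> u [u0 u1 yu]; apply/lp_ballP => //; exists u; split => // i.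
apply: le_trans (yu i) _; apply: powR_le_exp; first exact: sum_le1_le1.
  exact: rexp_ge0.
exact: rexp_antitone.
Qed.

Lemma lp_norm_power_mean N p q (x : 'rV[R]_N) : (0 < N)%N ->
  (1%:E <= p)%E -> (p <= q)%E ->
  lp_norm p x <= N%:R `^ (rexp p - rexp q) * lp_norm q x.
Proof.
move=> N0 p1 pq; have q1 : (1%:E <= q)%E by exact: le_trans pq.
have N0R : 0 < N%:R :> R by rewrite ltr0n.
have Np (e : R) : 0 < N%:R `^ e by exact: powR_gt0.
apply: lp_norm_le_scale => // y /lp_ballP-/(_ q1)[u [u0 u1 yu]].
set a := rexp p; set b := rexp q.
have ba : b <= a by exact: rexp_antitone.
have b0 : 0 <= b by exact: rexp_ge0.
have [a0|an0] := eqVneq a 0.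
  have b00 : b = 0 by lra.
  rewrite a0 b00 subr0 powRr0; apply/lp_ballP => //; exists u; split => // i.
  by rewrite -/a a0 -b00.
have a0 : 0 < a by rewrite lt_neqAle eq_sym an0 (le_trans b0).
suff h : lp_norm p (N%:R `^ (- (a - b)) *: y) <= 1.
  by move: h; rewrite lp_normZ// gtr0_norm// powRN mulrC ler_pdivrMr// mul1r.
(* The weights for the l_p ball mix u with the uniform weight 1/N in the proportion t to 1 - t; by
   AM-GM they dominate the geometric mix, whose power a is u_i^b N^(-(a-b)). *)
pose t := b / a.
have t0 : 0 <= t by rewrite divr_ge0// ltW.
have t1 : t <= 1 by rewrite ler_pdivrMr// mul1r.
apply/lp_ballP => //; exists (fun i => t * u i + (1 - t) * N%:R^-1).
have w0 i : 0 <= t * u i + (1 - t) * N%:R^-1.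
  by rewrite addr_ge0// mulr_ge0// ?subr_ge0// invr_ge0 ltW.
split => // [|i].
  rewrite big_split/= -mulr_sumr sumr_const card_ord -[_ *+ N]mulr_natr.
  rewrite divfK ?lt0r_neq0//; nra.
rewrite mxE normrM gtr0_norm// -/a.
apply: (@le_trans _ _ ((u i `^ t * N%:R^-1 `^ (1 - t)) `^ a)); last first.
  apply: ge0_ler_powR; rewrite ?nnegrE ?mulr_ge0 ?powR_ge0//; first exact: ltW.
  have := @weighted_amgm (u i) N%:R^-1 1 t (1 - t) 0 (u0 i).
  rewrite powRr0 mulr1 mul0r !addr0; apply; rewrite ?subr_ge0//.
  by rewrite addrC subrK.
rewrite powRM ?powR_ge0// -!powRrM divfK// -powR_inv1 ?ler0n// -powRrM.
rewrite mulN1r [- ((1 - t) * a)](_ : _ = - (a - b)); last by rewrite /t; field.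
by rewrite mulrC ler_wpM2r ?powR_ge0.
Qed.

Lemma lp_pairing N p q (x y : 'rV[R]_N) : (0 < N)%N ->
  (1%:E <= p)%E -> (1%:E <= q)%E ->
  \sum_i `|x 0 i * y 0 i| <=
  N%:R `^ (Num.max 0 (1 - rexp p - rexp q)) * lp_norm p x * lp_norm q y.
Proof.
move=> N0 p1 q1.
have N0R : 0 < N%:R :> R by rewrite ltr0n.
suff H (x' y' : 'rV[R]_N) : lp_norm p x' <= 1 -> lp_norm q y' <= 1 ->
    \sum_i `|x' 0 i * y' 0 i| <= N%:R `^ (Num.max 0 (1 - rexp p - rexp q)).
  have [/(lp_norm_eq0 p1) ->|xn0] := eqVneq (lp_norm p x) 0.
    rewrite big1 => [|i _]; last by rewrite mxE mul0r normr0.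
    by rewrite !mulr_ge0 ?powR_ge0 ?lp_norm_ge0.
  have [/(lp_norm_eq0 q1) ->|yn0] := eqVneq (lp_norm q y) 0.
    rewrite big1 => [|i _]; last by rewrite mxE mulr0 normr0.
    by rewrite !mulr_ge0 ?powR_ge0 ?lp_norm_ge0.
  have x0 : 0 < lp_norm p x by rewrite lt_neqAle eq_sym xn0 lp_norm_ge0.
  have y0 : 0 < lp_norm q y by rewrite lt_neqAle eq_sym yn0 lp_norm_ge0.
  have := H ((lp_norm p x)^-1 *: x) ((lp_norm q y)^-1 *: y).
  rewrite !lp_normZ// !gtr0_norm ?invr_gt0// !mulVf// => /(_ (lexx _) (lexx _)).
  under eq_bigr do rewrite !mxE mulrACA normrM.
  rewrite -mulr_sumr gtr0_norm ?mulr_gt0 ?invr_gt0// -invfM mulrC.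
  by rewrite ler_pdivrMr ?mulr_gt0// mulrA.
move=> /lp_ballP-/(_ p1)[u [u0 u1 xu]] /lp_ballP-/(_ q1)[v [v0 v1 yv]].
set a := rexp p; set b := rexp q.
have a0 : 0 <= a by exact: rexp_ge0.
have a1 : a <= 1 by exact: rexp_le1.
have b0 : 0 <= b by exact: rexp_ge0.
(* The exponents have to sum to 1. If a + b exceeds 1, then b is lowered, which is allowed for
   weights at most 1; if it falls short, the rest c goes to the weight 1/N and costs N^c. *)
pose b' := Num.min b (1 - a); pose c := 1 - a - b'.
have b'0 : 0 <= b' by rewrite le_min b0 subr_ge0.
have c0 : 0 <= c by rewrite /c subr_ge0 ge_min lexx orbT.
have -> : Num.max 0 (1 - a - b) = c.
  by rewrite /c /b'; case: (leP b (1 - a)) => h; [rewrite max_r|rewrite max_l]; lra.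
have abc : a + b' + c = 1 by rewrite /c; lra.
apply: (@le_trans _ _ (\sum_i (N%:R `^ c *
    (a * u i + b' * v i + c * N%:R^-1)))); last first.
  rewrite -mulr_sumr ler_piMr ?powR_ge0// !big_split/= -!mulr_sumr.
  rewrite sumr_const card_ord -[_ *+ N]mulr_natr.
  rewrite mulVf ?lt0r_neq0//; nra.
apply: ler_sum => i _; rewrite normrM.
apply: (@le_trans _ _ (u i `^ a * v i `^ b')).
  apply: ler_pM => //.
  apply: le_trans (yv i) _; apply: powR_le_exp => //; first exact: sum_le1_le1.
  by rewrite ge_min lexx.
have iN0 : 0 <= N%:R^-1 :> R by rewrite invr_ge0 ltW.
have := weighted_amgm (u0 i) (v0 i) iN0 a0 b'0 c0 abc.
have -> : N%:R^-1 `^ c = (N%:R `^ c)^-1 :> R.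
  by rewrite -powR_inv1 ?ler0n// -powRrM mulN1r powRN.
by rewrite ler_pdivrMr ?powR_gt0// => h; rewrite [leRHS]mulrC.
Qed.

End lp.

(** * QR decomposition *)

Section triangular.
Context {R : realType}.

(** H is the reflection along v = w - |w| e, or the identity if v vanishes. The sign of |w| e is
    chosen so that a is positive. *)
Lemma householder n (w : 'cV[R]_n.+1) : w != 0 -> exists (H : 'M[R]_n.+1) (a : R),
  [/\ H *m H^T = 1%:M, 0 < a & H *m w = a *: delta_mx 0 0].
Proof.
move=> wn0; pose e : 'cV[R]_n.+1 := delta_mx 0 0.
pose dot (x y : 'cV[R]_n.+1) := \sum_i x i 0 * y i 0.
have dotE x y : x^T *m y = (dot x y)%:M.
  rewrite [LHS]mx11_scalar !mxE; congr (_%:M).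
  by apply: eq_bigr => i _; rewrite mxE.
have dot_ge0 x : 0 <= dot x x.
  by apply: sumr_ge0 => i _; rewrite -expr2 sqr_ge0.
have dot_eq0 x : dot x x = 0 -> x = 0.
  move=> /eqP; rewrite psumr_eq0 => [/allP h|i _]; last by rewrite -expr2 sqr_ge0.
  apply/matrixP => i j; rewrite !ord1 mxE; apply/eqP.
  by have := h i (mem_index_enum _); rewrite mulf_eq0 orbb.
have ww0 : 0 < dot w w.
  rewrite lt_neqAle dot_ge0 andbT eq_sym; apply/eqP => /dot_eq0 w0.
  by rewrite w0 eqxx in wn0.
pose a := Num.sqrt (dot w w).
have a0 : 0 < a by rewrite sqrtr_gt0.
have aa : a * a = dot w w by rewrite -expr2 sqr_sqrtr.
pose v := w - a *: e.
have vE : w = v + a *: e by rewrite subrK.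
have [v0|vn0] := eqVneq v 0.
  exists 1%:M, a; split => //; first by rewrite trmx1 mulmx1.
  by rewrite mul1mx vE v0 add0r.
pose b := dot v v.
have b0 : b != 0 by apply/eqP => /dot_eq0 h; rewrite h eqxx in vn0.
have ee : dot e e = 1.
  rewrite /dot (bigD1 ord0)//= big1 => [|i /negbTE i0]; last by rewrite !mxE i0 mul0r.
  by rewrite !mxE eqxx mulr1 addr0.
(* Since w and a e have equal length, (2 / b) <v, w> = 1, so that H w = w - v. *)
have bE : 2 * dot v w = b.
  have dvw : dot v w = dot w w - a * dot e w.
    rewrite /dot mulr_sumr -sumrB; apply: eq_bigr => i _.
    by rewrite !mxE /=; ring.
  have -> : b = dot w w - 2 * a * dot e w + a * a * dot e e.
    rewrite /b /dot !mulr_sumr -sumrB -big_split/=; apply: eq_bigr => i _.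
    by rewrite !mxE /=; ring.
  by rewrite dvw ee aa; ring.
pose H := 1%:M - (2 / b) *: (v *m v^T).
have HT : H^T = H.
  by rewrite /H linearB/= linearZ/= trmx_mul trmxK trmx1.
exists H, a; split => //.
  rewrite HT /H mulmxBl mul1mx mulmxBr mulmx1 -scalemxAl -scalemxAr scalerA.
  rewrite -mulmxA (mulmxA v^T) dotE mul_scalar_mx -scalemxAr scalerA.
  rewrite -/b [2 / b * (2 / b) * b](_ : _ = 2 / b + 2 / b); last by field.
  by rewrite scalerDl opprB addrK subrK.
rewrite /H mulmxBl mul1mx -scalemxAl -mulmxA dotE mul_mx_scalar scalerA.
rewrite [_ * _](_ : _ = 1); last by rewrite mulrAC bE divff.
by rewrite scale1r {1}vE addrC addKr.
Qed.

(** A reflection clears the first column and the induction treats the lower right block. The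
    positive diagonal is what [vol_triangular] asks for. *)
Lemma qr_decomposition N (T : 'M[R]_N) : T \in unitmx ->
  exists Q L : 'M[R]_N, [/\ Q *m Q^T = 1%:M, T = Q *m L,
    forall i j : 'I_N, (j < i)%N -> L i j = 0 & forall i, 0 < L i i].
Proof.
elim: N T => [|N IH] T uT.
  by exists 1%:M, T; split=> [||[]//|[]//]; rewrite ?trmx1 ?mul1mx ?mulmx1.
pose T1 : 'M[R]_(1 + N) := T.
have w0 : col ord0 T != 0.
  apply/eqP => cT; have := uT; rewrite unitmxE (expand_det_col _ ord0).
  rewrite big1 ?unitr0// => i _.
  by move/matrixP/(_ i ord0): cT; rewrite !mxE => ->; rewrite mul0r.
have [H [a [HH a0 Hw]]] := householder w0.
pose S : 'M[R]_(1 + N) := H *m T.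
have cS i : S i ord0 = a * (i == ord0)%:R.
  move/matrixP/(_ i ord0): Hw; rewrite !mxE eqxx andbT => <-.
  by apply: eq_bigr => j _; rewrite mxE.
have lift0 : lshift N (ord0 : 'I_1) = ord0 by exact: val_inj.
have lift1 (i : 'I_N) : rshift 1 i = lift ord0 i by exact: val_inj.
have Sb : S = block_mx (a%:M : 'M[R]_1) (ursubmx S) 0 (drsubmx S).
  rewrite -[LHS]submxK; congr block_mx; apply/matrixP => i j; rewrite !ord1.
    by rewrite 2!mxE lift0 cS eqxx mulr1 mxE eqxx mulr1n.
  by rewrite 2!mxE lift0 cS lift1 mulr0 mxE.
have uH : H \in unitmx.
  by rewrite unitmxE; have := congr1 determinant HH; rewrite det_mulmx det1 det_tr =>
    h; apply/unitrP; exists (\det H).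
have uS : drsubmx S \in unitmx.
  have : S \in unitmx by rewrite unitmx_mul uH.
  by rewrite {1}Sb !unitmxE det_ublock unitrM => /andP[].
have [Q [L [QQ SE L0 Lp]]] := IH _ uS.
pose Q1 : 'M[R]_(1 + N) := block_mx (1%:M : 'M[R]_1) 0 0 Q.
pose L1 : 'M[R]_(1 + N) := block_mx (a%:M : 'M[R]_1) (ursubmx S) 0 L.
have S1 : S = Q1 *m L1.
  by rewrite mulmx_block !mul1mx !mulmx0 !mul0mx !addr0 !add0r -SE -Sb.
have QQ1 : Q1 *m Q1^T = 1%:M.
  rewrite tr_block_mx !trmx0 trmx1 mulmx_block !mul1mx !mulmx0 !mul0mx.
  by rewrite !addr0 !add0r QQ -scalar_mx_block.
exists (H^T *m Q1), L1; split.
- by rewrite trmx_mul trmxK -mulmxA (mulmxA Q1) QQ1 mul1mx (mulmx1C HH).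
- by rewrite -mulmxA -S1 /S mulmxA (mulmx1C HH) mul1mx.
- move=> i j; case: (unliftP ord0 i) => [i'|] ->//.
  case: (unliftP ord0 j) => [j'|] ->.
    rewrite !fintype.lift0 ltnS -!lift1 => /L0 <-; exact: block_mxEdr.
  move=> _; rewrite -lift1 -lift0; apply: etrans (block_mxEdl _ _ _ _ _ _) _.
  by rewrite mxE.
- move=> i; case: (unliftP ord0 i) => [i'|] ->.
    by rewrite -!lift1 (_ : L1 _ _ = L i' i')//; exact: block_mxEdr.
  rewrite -!lift0 (_ : L1 _ _ = a)//; apply: etrans (block_mxEul _ _ _ _ _ _) _.
  by rewrite mxE eqxx mulr1n.
Qed.

End triangular.

(** * Tensors and the projective norm *)

Section tensors.
Context {R : realType}.

(** The three dimensions may differ because the slice argument takes place in R^n (x) R^n (x)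
    R^1. *)
Definition idx3 n1 n2 n3 (i : 'I_n1) (j : 'I_n2) (k : 'I_n3) :
  'I_(n1 * n2 * n3) := mxtens_index (mxtens_index (i, j), k).

Lemma idx3_inj n1 n2 n3 (i i' : 'I_n1) (j j' : 'I_n2) (k k' : 'I_n3) :
  (idx3 i j k == idx3 i' j' k') = [&& i == i', j == j' & k == k'].
Proof.
rewrite /idx3 (inj_eq (can_inj (@mxtens_indexK _ _))) xpair_eqE.
by rewrite (inj_eq (can_inj (@mxtens_indexK _ _))) xpair_eqE andbA.
Qed.

Lemma idx3P n1 n2 n3 (a : 'I_(n1 * n2 * n3)) :
  exists i j k, a = idx3 i j k.
Proof.
exists (mxtens_unindex (mxtens_unindex a).1).1.
exists (mxtens_unindex (mxtens_unindex a).1).2, (mxtens_unindex a).2.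
by rewrite /idx3 -surjective_pairing mxtens_unindexK -surjective_pairing
  mxtens_unindexK.
Qed.

Lemma sum_mxtens_index (V : nmodType) m n (F : 'I_(m * n) -> V) :
  \sum_a F a = \sum_i \sum_j F (mxtens_index (i, j)).
Proof.
rewrite (reindex (@mxtens_index m n)) /=; last first.
  by apply: onW_bij; exists (@mxtens_unindex m n);
    [exact: mxtens_indexK|exact: mxtens_unindexK].
by rewrite pair_bigA; apply: eq_bigr => -[].
Qed.

Lemma sum_idx3 (V : nmodType) n1 n2 n3 (F : 'I_(n1 * n2 * n3) -> V) :
  \sum_a F a = \sum_i \sum_j \sum_k F (idx3 i j k).
Proof. by rewrite sum_mxtens_index sum_mxtens_index. Qed.

(* Convertible to [tensor3] when the three dimensions agree. *)
Definition tens n1 n2 n3 (x : 'rV[R]_n1) (y : 'rV[R]_n2) (z : 'rV[R]_n3) :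
  'rV[R]_(n1 * n2 * n3) := tensmx (tensmx x y) z.

Lemma tensE n1 n2 n3 (x : 'rV[R]_n1) (y : 'rV[R]_n2) (z : 'rV[R]_n3) i j k :
  tens x y z 0 (idx3 i j k) = x 0 i * y 0 j * z 0 k.
Proof.
(* The only row index, written in the form to which [tensmxE] applies. *)
pose o : 'I_(1 * 1 * 1) := mxtens_index (mxtens_index (0 : 'I_1, 0 : 'I_1), 0 : 'I_1).
have -> : tens x y z 0 (idx3 i j k) = tens x y z o (idx3 i j k).
  by congr (tens _ _ _ _ _); exact: val_inj.
by rewrite [LHS]tensmxE [X in X * _]tensmxE.
Qed.

Lemma rV_idx3P n1 n2 n3 (A B : 'rV[R]_(n1 * n2 * n3)) :
  (forall i j k, A 0 (idx3 i j k) = B 0 (idx3 i j k)) -> A = B.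
Proof. by move=> h; apply/rowP => a; have [i [j [k ->]]] := idx3P a. Qed.

Definition fiber n (A : 'rV[R]_(n * n * n)) i j : 'rV[R]_n :=
  \row_k A 0 (idx3 i j k).

(** These n^2 elementary tensors show that the infimum is over a nonempty set; they also give the
    bound n for the identity and the cube inside the ball. *)
Lemma fiber_decomposition n (A : 'rV[R]_(n * n * n)) :
  A = \sum_(ij : 'I_n * 'I_n)
    tensor3 (delta_mx 0 ij.1) (delta_mx 0 ij.2) (fiber A ij.1 ij.2).
Proof.
apply: rV_idx3P => i j k; rewrite summxE (bigD1 (i, j))//= big1.
  by rewrite addr0 [RHS]tensE !mxE !eqxx !mul1r.
move=> [i' j'] /=; rewrite xpair_eqE => h; rewrite [LHS]tensE !mxE !eqxx/=.
rewrite ![_ == i'](eq_sym) ![_ == j'](eq_sym).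
by case: (i' == i) h => //=; rewrite ?mul0r// => /negbTE ->; rewrite mulr0 mul0r.
Qed.

Lemma norm2_fibers n (A : 'rV[R]_(n * n * n)) :
  lp_norm 2%:E A ^+ 2 = \sum_i \sum_j lp_norm 2%:E (fiber A i j) ^+ 2.
Proof.
rewrite lp_norm2_sqr sum_idx3; apply: eq_bigr => i _; apply: eq_bigr => j _.
by rewrite lp_norm2_sqr; apply: eq_bigr => k _; rewrite mxE.
Qed.

(** Cauchy-Schwarz against the constant 1, by expanding the double sum of (a_i - a_j)^2. *)
Lemma sqr_sum_le (I : finType) (a : I -> R) :
  (\sum_i a i) ^+ 2 <= #|I|%:R * \sum_i a i ^+ 2.
Proof.
have : 0 <= \sum_i \sum_j (a i - a j) ^+ 2.
  by apply: sumr_ge0 => i _; apply: sumr_ge0 => j _; exact: sqr_ge0.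
have -> : \sum_i \sum_j (a i - a j) ^+ 2 =
    2 * (#|I|%:R * \sum_i a i ^+ 2) - 2 * (\sum_i a i) ^+ 2.
  transitivity (\sum_i (#|I|%:R * a i ^+ 2 + \sum_j a j ^+ 2 -
      2 * a i * \sum_j a j)).
    apply: eq_bigr => i _.
    transitivity (\sum_j (a i ^+ 2 + a j ^+ 2 - 2 * a i * a j)).
      by apply: eq_bigr => j _; ring.
    by rewrite sumrB big_split/= sumr_const -mulr_sumr -[_ *+ #|I|]mulr_natl.
  rewrite sumrB big_split/= sumr_const -mulr_sumr -mulr_suml -mulr_sumr.
  by rewrite -[_ *+ #|I|]mulr_natl; ring.
lra.
Qed.

Lemma sum_le_sqrt (I : finType) (a : I -> R) (S : R) : 0 <= S ->
  \sum_i a i ^+ 2 <= S -> \sum_i a i <= Num.sqrt (#|I|%:R * S).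
Proof.
move=> S0 h; apply: le_trans (ler_norm _) _; rewrite -sqrtr_sqr.
apply: ler_wsqrtr; apply: le_trans (sqr_sum_le a) _.
by rewrite ler_wpM2l// ler0n.
Qed.

Definition flip_at (I : finType) (k : I) (e : {ffun I -> bool}) :=
  [ffun i => (i == k) (+) e i].

(** Orthogonality of Rademacher signs: for distinct k and l, flipping the k-th sign permutes the
    sign vectors and negates every term. *)
Lemma sum_signs (I : finType) (k l : I) :
  \sum_(e : {ffun I -> bool}) (-1) ^+ e k * (-1) ^+ e l =
  (if k == l then 2 ^+ #|I| else 0) :> R.
Proof.
case: eqVneq => [->|kl].
  under eq_bigr do rewrite -expr2 sqrr_sign.
  by rewrite sumr_const card_ffun card_bool natrX.
have fI : injective (@flip_at I k).
  by apply: can_inj (flip_at k) _ => e; apply/ffunP => i; rewrite !ffunE addKb.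
set S := (X in X = 0); suff : S = - S by move=> h; lra.
rewrite {1}/S (reindex_inj fI) -sumrN; apply: eq_bigr => e _.
rewrite !ffunE eqxx [l == k]eq_sym (negbTE kl) addFb.
by rewrite signr_addb expr1 mulN1r mulNr.
Qed.

End tensors.

(** * The projective norm: basic properties, duality, upper bounds *)

Section projective_norm.
Context {R : realType} (p q r : \bar R).
Hypotheses (p1 : (1%:E <= p)%E) (q1 : (1%:E <= q)%E) (r1 : (1%:E <= r)%E).
Variable n : nat.
Local Notation pn := (@proj_norm R n p q r).
Implicit Types A B : 'rV[R]_(n * n * n).

Lemma proj_cost_ge0 (I : finType) (x y z : I -> 'rV[R]_n) :
  0 <= \sum_l lp_norm p (x l) * lp_norm q (y l) * lp_norm r (z l).
Proof. by apply: sumr_ge0 => l _; rewrite !mulr_ge0// lp_norm_ge0. Qed.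

Lemma proj_norm_le (I : finType) (x y z : I -> 'rV[R]_n) :
  pn (\sum_l tensor3 (x l) (y l) (z l)) <=
  \sum_l lp_norm p (x l) * lp_norm q (y l) * lp_norm r (z l).
Proof.
apply: ge_inf.
  by exists 0 => _ [m [x' [y' [z' [_ ->]]]]]; exact: proj_cost_ge0.
pose f := @enum_val I predT.
have bf : {on [pred _ | true], bijective f}.
  by apply: onW_bij; exact: enum_val_bij.
eexists; exists (x \o f), (y \o f), (z \o f).
by split; rewrite (reindex f).
Qed.

Lemma proj_norm_lt A e : 0 < e ->
  exists m (x y z : 'I_m -> 'rV[R]_n),
    A = \sum_l tensor3 (x l) (y l) (z l) /\
    \sum_l lp_norm p (x l) * lp_norm q (y l) * lp_norm r (z l) < pn A + e.
Proof.
move=> e0; have [||_ [m [x [y [z [AE ->]]]]] h] :=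
  @inf_adherent R [set s | exists m (x y z : 'I_m -> 'rV[R]_n),
    A = \sum_(l < m) tensor3 (x l) (y l) (z l) /\
    s = \sum_(l < m) lp_norm p (x l) * lp_norm q (y l) * lp_norm r (z l)] e.
- exact: e0.
- split; last first.
    by exists 0 => _ [m [x' [y' [z' [_ ->]]]]]; exact: proj_cost_ge0.
  eexists; eexists; pose f := @enum_val ('I_n * 'I_n)%type predT.
  exists (fun l => delta_mx 0 (f l).1), (fun l => delta_mx 0 (f l).2).
  exists (fun l => fiber A (f l).1 (f l).2); split; last by [].
  rewrite {1}[A]fiber_decomposition (reindex f)//.
  by apply: onW_bij; exact: enum_val_bij.
- by exists m, x, y, z.
Qed.

Lemma proj_norm_tensor (x y z : 'rV[R]_n) :
  pn (tensor3 x y z) <= lp_norm p x * lp_norm q y * lp_norm r z.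
Proof.
by have := proj_norm_le (fun=> x : _) (fun=> y) (fun _ : 'I_1 => z); rewrite !big_ord1.
Qed.

Lemma proj_normD A B : pn (A + B) <= pn A + pn B.
Proof.
apply/ler_addgt0Pr => e e0; have e20 : 0 < e / 2 by rewrite divr_gt0.
have [m [x [y [z [AE hA]]]]] := proj_norm_lt A e20.
have [m' [x' [y' [z' [BE hB]]]]] := proj_norm_lt B e20.
pose glue (f : 'I_m -> 'rV[R]_n) f' (l : 'I_m + 'I_m') :=
  match l with inl l => f l | inr l => f' l end.
have := proj_norm_le (glue x x') (glue y y') (glue z z').
rewrite !big_sumType/= -AE -BE => /le_trans; apply; lra.
Qed.

Lemma proj_norm_sum (I : finType) (A : I -> 'rV[R]_(n * n * n)) :
  pn (\sum_i A i) <= \sum_i pn (A i).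
Proof.
elim/big_rec2: _ => [|i s B _ h].
  (* The empty decomposition bounds the norm of 0 by 0. *)
  have := @proj_norm_le void (fun=> 0) (fun=> 0) (fun=> 0).
  by rewrite !big_pred0.
by apply: le_trans (proj_normD _ _) _; rewrite lerD2l.
Qed.

(** A linear map is controlled by its values on elementary tensors, as a near-optimal decomposition
    shows. Applied to scalars and to the symmetries of the ball. *)
Lemma proj_normM (G : 'M[R]_(n * n * n)) A (c : R) : 0 <= c ->
  (forall x y z, pn (tensor3 x y z *m G) <=
     c * (lp_norm p x * lp_norm q y * lp_norm r z)) ->
  pn (A *m G) <= c * pn A.
Proof.
move=> c0 h; have [c00|cn0] := eqVneq c 0.
  have [m [x [y [z [-> _]]]]] := proj_norm_lt A ltr01.
  rewrite mulmx_suml c00 mul0r; apply: le_trans (proj_norm_sum _) _.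
  apply: sumr_le0 => l _.
  by apply: le_trans (h _ _ _) _; rewrite c00 mul0r.
have {cn0}c0 : 0 < c by rewrite lt_neqAle eq_sym cn0.
apply/ler_addgt0Pr => e e0; have ec0 : 0 < e / c by rewrite divr_gt0.
have [m [x [y [z [AE hA]]]]] := proj_norm_lt A ec0.
rewrite {1}AE mulmx_suml; apply: le_trans (proj_norm_sum _) _.
apply: (@le_trans _ _ (c * (pn A + e / c))); last first.
  by rewrite mulrDr mulrCA divff ?mulr1// lt0r_neq0.
apply: le_trans (ler_wpM2l (ltW c0) (ltW hA)); rewrite mulr_sumr.
by apply: ler_sum => l _; exact: h.
Qed.

Lemma proj_normZ (a : R) A : pn (a *: A) <= `|a| * pn A.
Proof.
rewrite -mul_mx_scalar; apply: proj_normM => // x y z.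
have -> : tensor3 x y z *m a%:M = tensor3 (a *: x) y z.
  rewrite mul_mx_scalar; apply: rV_idx3P => i j k.
  by rewrite mxE [X in _ * X]tensE [RHS]tensE !mxE !mulrA.
by apply: le_trans (proj_norm_tensor _ _ _) _; rewrite lp_normZ// !mulrA.
Qed.

(** The easy half of the duality with trilinear forms: lower bounds for the projective norm come
    from test forms B through this inequality. *)
Lemma proj_norm_dual (B : 'rV[R]_(n * n * n)) (M : R) A : 0 <= M ->
  (forall x y z, \sum_a B 0 a * tensor3 x y z 0 a <=
     M * (lp_norm p x * lp_norm q y * lp_norm r z)) ->
  \sum_a B 0 a * A 0 a <= M * pn A.
Proof.
move=> M0 h; apply/ler_addgt0Pr => e e0.
(* Dividing by M + 1 covers the case M = 0. *)
have eM0 : 0 < e / (M + 1) by rewrite divr_gt0//; lra.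
have [m [x [y [z [AE hA]]]]] := proj_norm_lt A eM0.
apply: (@le_trans _ _ (M * (pn A + e / (M + 1)))); last first.
  rewrite mulrDr lerD2l mulrCA ler_piMr//; first exact: ltW.
  by rewrite ler_pdivrMr; lra.
apply: le_trans (ler_wpM2l M0 (ltW hA)); rewrite mulr_sumr {1}AE.
under eq_bigr do rewrite summxE mulr_sumr.
by rewrite exchange_big/=; apply: ler_sum => l _; exact: h.
Qed.

Section upper_bounds.
Hypotheses (q2 : (q <= 2%:E)%E) (r2 : (2%:E <= r)%E).

(** As r >= 2, each fibre costs at most its l_2 norm; Cauchy-Schwarz over the n^2 fibres gives the
    factor n. *)
Lemma proj_norm_le_dim A : pn A <= n%:R * lp_norm 2%:E A.
Proof.
rewrite {1}[A]fiber_decomposition.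
apply: le_trans (proj_norm_le _ _ _) _.
apply: (@le_trans _ _ (\sum_(ij : 'I_n * 'I_n)
    lp_norm 2%:E (fiber A ij.1 ij.2))).
  apply: ler_sum => ij _; rewrite !lp_norm_delta// !mul1r.
  by apply: lp_norm_antitone => //; rewrite lee_fin; lra.
have N0 := lp_norm_ge0 2%:E A.
apply: le_trans (sum_le_sqrt (sqr_ge0 (lp_norm 2%:E A)) _) _.
  by rewrite norm2_fibers pair_bigA.
rewrite card_prod card_ord natrM -expr2 sqrtrM ?sqr_ge0// !sqrtr_sqr.
by rewrite !ger0_norm.
Qed.

Let sgn (e : {ffun 'I_n -> bool}) : 'rV[R]_n := \row_k (-1) ^+ e k.
Let average A (e : {ffun 'I_n -> bool}) i : 'rV[R]_n :=
  \row_j \sum_k A 0 (idx3 i j k) * (-1) ^+ e k.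

Lemma lp_norm_sgn e : (0 < n)%N -> lp_norm r (sgn e) <= n%:R `^ rexp r.
Proof.
move=> n0; apply: le_trans (lp_norm_power_mean _ n0 r1 (leey r)) _.
rewrite rexp_oo subr0 ler_piMr ?powR_ge0//=.
elim/big_ind: _ => // [a b a1 b1|i _]; first by rewrite ge_max a1.
by rewrite mxE normrX normrN normr1 expr1n.
Qed.

(* [A] is the average over the signs [e] of the sum of the tensors of [e_i],
   of the contraction of the i-th slice with [e], and of [e]. *)
Lemma proj_norm_le_sign A : (0 < n)%N ->
  pn A <= n%:R `^ (rexp q + rexp r) * lp_norm 2%:E A.
Proof.
move=> n0; have n0R : 0 < n%:R :> R by rewrite ltr0n.
pose c : R := 2 ^- n.
have c0 : 0 < c by rewrite invr_gt0 exprn_gt0.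
have AE : A = \sum_(ei : {ffun 'I_n -> bool} * 'I_n)
    tensor3 (delta_mx 0 ei.2) (c *: average A ei.1 ei.2) (sgn ei.1).
  apply: rV_idx3P => i j k; rewrite summxE.
  transitivity (\sum_(e : {ffun 'I_n -> bool}) c *
      (\sum_l A 0 (idx3 i j l) * (-1) ^+ e l) * (-1) ^+ e k).
    under eq_bigr do rewrite -mulrA mulr_suml.
    rewrite -mulr_sumr exchange_big/=.
    under eq_bigr => l _.
      under eq_bigr do rewrite -mulrA.
      rewrite -mulr_sumr sum_signs; over.
    rewrite (bigD1 k)//= eqxx big1 => [|l /negbTE ->]; last by rewrite mulr0.
    by rewrite addr0 card_ord mulrCA mulVf ?mulr1// expf_neq0.
  rewrite -(pair_bigA _ (fun e i' => tensor3 (delta_mx 0 i' : 'rV[R]_n)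
    (c *: average A e i') (sgn e) 0 (idx3 i j k)))/=.
  apply: eq_bigr => e _; rewrite [RHS](bigD1 i)//=.
  rewrite [X in _ = _ + X]big1 => [|i' i'i].
    by rewrite addr0 [RHS]tensE !mxE !eqxx mul1r.
  by rewrite [LHS]tensE !mxE eqxx [i == i']eq_sym (negbTE i'i) !mul0r.
rewrite {1}AE; apply: le_trans (proj_norm_le _ _ _) _.
(* The first factor compares l_q with l_2, the second is the l_r norm of a sign vector. The
   remaining n^(1/2) comes from Cauchy-Schwarz over the 2^n n pairs (e, i). *)
pose K := n%:R `^ (rexp q - 2^-1) * n%:R `^ rexp r.
apply: (@le_trans _ _ (\sum_(ei : {ffun 'I_n -> bool} * 'I_n)
    c * K * lp_norm 2%:E (average A ei.1 ei.2))).
  apply: ler_sum => -[e i] _ /=; rewrite lp_norm_delta// mul1r lp_normZ//.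
  rewrite gtr0_norm// /K -!mulrA ler_pM2l// [leRHS]mulrCA [leRHS]mulrC.
  apply: ler_pM; rewrite ?lp_norm_ge0//.
    have := lp_norm_power_mean (average A e i) n0 q1 q2.
    by rewrite (@rexpE _ 2)//; lra.
  exact: lp_norm_sgn.
rewrite -mulr_sumr.
have N0 := lp_norm_ge0 2%:E A.
have K0 : 0 <= K by rewrite mulr_ge0// powR_ge0.
have e20 : 0 <= 2 ^+ n :> R by rewrite exprn_ge0.
apply: (@le_trans _ _ (c * K *
    Num.sqrt ((2 ^+ n * n%:R) * (2 ^+ n * lp_norm 2%:E A ^+ 2)))).
  rewrite ler_wpM2l//; first by rewrite mulr_ge0// ltW.
  have cardE : (#|{: {ffun 'I_n -> bool} * 'I_n}|)%:R = 2 ^+ n * n%:R :> R.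
    by rewrite card_prod card_ffun card_bool !card_ord natrM natrX.
  rewrite -cardE; apply: sum_le_sqrt.
    by rewrite mulr_ge0// sqr_ge0.
  rewrite -(pair_bigA _ (fun e i => lp_norm 2%:E (average A e i) ^+ 2))/=.
  (* By orthogonality of the signs, the squared norms of the contractions sum to 2^n times that of
     A. *)
  rewrite exchange_big/= norm2_fibers mulr_sumr; apply: ler_sum => i _.
  under eq_bigr do rewrite lp_norm2_sqr.
  rewrite exchange_big/= mulr_sumr; apply: ler_sum => j _.
  rewrite lp_norm2_sqr.
  under eq_bigr do rewrite mxE expr2 mulr_suml.
  rewrite exchange_big/= mulr_sumr; apply: ler_sum => k _.
  under eq_bigr do rewrite mulr_sumr.
  rewrite exchange_big/= (bigD1 k)//= [X in _ + X]big1 => [|l lk].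
    under eq_bigr do rewrite mulrACA.
    rewrite -mulr_sumr sum_signs eqxx card_ord addr0 mxE -expr2 mulrC.
    by rewrite ler_wpM2l.
  under eq_bigr do rewrite mulrACA.
  by rewrite -mulr_sumr sum_signs [k == l]eq_sym (negbTE lk) mulr0.
rewrite [X in Num.sqrt X](_ : _ = (2 ^+ n) ^+ 2 * (n%:R * lp_norm 2%:E A ^+ 2)); last first.
  by ring.
rewrite sqrtrM ?sqr_ge0// sqrtr_sqr ger0_norm// sqrtrM ?ler0n// sqrtr_sqr.
rewrite (ger0_norm N0); set S := Num.sqrt _; set W := lp_norm _ _.
have -> : c * K * (2 ^+ n * (S * W)) = K * S * W.
  by rewrite mulrACA mulVf ?expf_neq0// mul1r mulrA.
rewrite ler_wpM2r// /S /K -powR12_sqrt ?ler0n// mulrAC -powRD; last first.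
  by rewrite (lt0r_neq0 n0R) implybT.
by rewrite subrK -powRD// (lt0r_neq0 n0R) implybT.
Qed.

End upper_bounds.

End projective_norm.

(** * Volumes of convex hulls of tensors *)

Section empirical_method.
Context {R : realType} (q : R).
Hypotheses (q1 : 1 <= q) (q2 : q <= 2).

Let q0 : 0 < q. Proof. exact: lt_le_trans q1. Qed.

Lemma bernoulli_concave (x s : R) : -1 <= x -> 0 <= s <= 1 ->
  (1 + x) `^ s <= 1 + s * x.
Proof.
move=> x1 /andP[s0 s1].
have x10 : 0 <= 1 + x by lra.
have := @weighted_amgm R (1 + x) 1 1 s (1 - s) 0 x10 ler01 ler01 s0.
rewrite powR1 !mulr1 !addr0 => h.
apply: le_trans (h _ _ _) _ => //; lra.
Qed.

(** Convexity at the tangent point t = 0. Where the tangent is positive, this is the q-th power of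
    Bernoulli's inequality for the exponent 1/q. *)
Lemma powR_tangent_ge (t : R) : 1 + q * t <= `|1 + t| `^ q.
Proof.
have [q1' q2'] := (q1, q2).
have [h|h] := leP (1 + q * t) 0; first exact: le_trans h (powR_ge0 _ _).
have iq : 0 <= q^-1 <= 1 by rewrite invr_ge0 (ltW q0)/= invf_le1.
have qt1 : -1 <= q * t by lra.
have t1 : -1 <= t.
  rewrite leNgt; apply/negP => t1.
  have : 0 < q * (-1 - t) by rewrite mulr_gt0//; lra.
  lra.
have := bernoulli_concave qt1 iq; rewrite mulKf ?lt0r_neq0// => hb.
have -> : 1 + q * t = ((1 + q * t) `^ q^-1) `^ q.
  by rewrite -powRrM mulVf ?lt0r_neq0// powRr1// ltW.
rewrite ger0_norm; last lra.
apply: ge0_ler_powR => //; rewrite ?nnegrE ?powR_ge0//; [exact: ltW|lra].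
Qed.

Lemma powR_le4 : 2 `^ q <= 4.
Proof.
have [q1' q2'] := (q1, q2).
apply: (@le_trans _ _ (2 `^ 2%:R)); first by apply: ler_powR => //; lra.
by rewrite powR_mulrn// expr2; lra.
Qed.

(** The scalar inequality behind type q of l_q. For t in ]-1, 1] Bernoulli bounds (1+t)(1+t)^(q-1)
    by 1 + q t + (q-1) t^2, and t^2 <= |t|^q; for t > 1 the constant 4 bounds 2^q. *)
Lemma powR_tangent_le (t : R) :
  `|1 + t| `^ q <= 1 + q * t + 4 * `|t| `^ q.
Proof.
have [q1' q2'] := (q1, q2).
have tq := powR_ge0 `|t| q.
have [t1|t1] := leP t (-1).
  have h1 : `|1 + t| `^ q <= `|t| `^ q.
    apply: ge0_ler_powR; rewrite ?nnegrE//; first exact: ltW.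
    by rewrite !ler0_norm; lra.
  have h2 : `|t| <= `|t| `^ q.
    by apply: le1r_powR => //; rewrite ler0_norm; lra.
  have h3 : - (2 * `|t|) <= q * t by rewrite ler0_norm; nra.
  lra.
have t10 : 0 < 1 + t by lra.
have [t2|t2] := leP t 1; last first.
  have h1 : `|1 + t| `^ q <= (2 * `|t|) `^ q.
    apply: ge0_ler_powR; rewrite ?nnegrE ?mulr_ge0//; first exact: ltW.
    by rewrite !gtr0_norm; lra.
  rewrite powRM// in h1.
  have h2 := powR_le4.
  have : 2 `^ q * `|t| `^ q <= 4 * `|t| `^ q by rewrite ler_wpM2r.
  nra.
rewrite gtr0_norm//.
have -> : (1 + t) `^ q = (1 + t) * (1 + t) `^ (q - 1).
  by rewrite mulr_powRB1// ltW.
have hb : (1 + t) `^ (q - 1) <= 1 + (q - 1) * t.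
  apply: bernoulli_concave; first exact: ltW.
  by apply/andP; split; lra.
have h2 : t ^+ 2 <= `|t| `^ q.
  rewrite -[leLHS]ger0_norm ?sqr_ge0// normrX -powR_mulrn//.
  apply: powR_le_exp => //; last exact: ltW.
  by rewrite normr_ge0 ler_norml; apply/andP; split; lra.
apply: (@le_trans _ _ ((1 + t) * (1 + (q - 1) * t))); first by rewrite ler_pM2l.
rewrite expr2 in h2; nra.
Qed.

(** The derivative of |.|^q at a. As division by 0 gives 0, the value at a = 0 is 0, a subgradient
    also when q = 1. *)
Definition powR_slope (a : R) := q * `|a| `^ q / a.

Lemma powR_add_ge (a b : R) :
  `|a| `^ q + powR_slope a * b <= `|a + b| `^ q.
Proof.
have [->|a0] := eqVneq a 0.
  rewrite /powR_slope invr0 mulr0 mul0r addr0 add0r normr0 powR0 ?powR_ge0//.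
  exact: lt0r_neq0.
have -> : a + b = a * (1 + b / a) by field.
rewrite normrM powRM//.
have -> : `|a| `^ q + powR_slope a * b = `|a| `^ q * (1 + q * (b / a)).
  by rewrite /powR_slope; field.
by rewrite ler_wpM2l ?powR_ge0// powR_tangent_ge.
Qed.

Lemma powR_add_le (a b : R) :
  `|a + b| `^ q <= `|a| `^ q + powR_slope a * b + 4 * `|b| `^ q.
Proof.
have [->|a0] := eqVneq a 0.
  rewrite /powR_slope invr0 mulr0 mul0r addr0 add0r normr0 powR0; last first.
    exact: lt0r_neq0.
  by have := powR_ge0 `|b| q; lra.
have eb : `|b| `^ q = `|a| `^ q * `|b / a| `^ q.
  by rewrite -powRM// -normrM mulrC divfK.
have -> : a + b = a * (1 + b / a) by field.
rewrite normrM powRM// eb.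
have -> : `|a| `^ q + powR_slope a * b + 4 * (`|a| `^ q * `|b / a| `^ q) =
    `|a| `^ q * (1 + q * (b / a) + 4 * `|b / a| `^ q).
  by rewrite /powR_slope; field.
by rewrite ler_wpM2l ?powR_ge0// powR_tangent_le.
Qed.

Lemma powR_add_le4 (a b : R) : `|a + b| `^ q <= 4 * (`|a| `^ q + `|b| `^ q).
Proof.
have [q1' q2'] := (q1, q2).
have ha := powR_ge0 `|a| q; have hb := powR_ge0 `|b| q.
pose M := Num.max `|a| `|b|.
have M0 : 0 <= M by rewrite le_max normr_ge0.
apply: (@le_trans _ _ ((2 * M) `^ q)).
  apply: ge0_ler_powR; rewrite ?nnegrE ?mulr_ge0//; first exact: ltW.
  apply: le_trans (ler_normD _ _) _.
  have h1 : `|a| <= M by rewrite le_max lexx.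
  have h2 : `|b| <= M by rewrite le_max lexx orbT.
  lra.
rewrite powRM//; apply: ler_pM; rewrite ?powR_ge0//; first exact: powR_le4.
by rewrite /M; case: (leP `|a| `|b|) => _; rewrite ?lerDl ?lerDr ?powR_ge0.
Qed.

(* The next vector of [s] is chosen greedily, so that the linear term of
   [powR_add_le] is nonpositive; each step then costs a bounded amount. *)
Lemma maurey N (F : finType) (v : F -> 'rV[R]_N) (x : 'rV[R]_N) (D : R) :
  (forall f, \sum_j `|v f 0 j| `^ q <= D) ->
  (forall c : 'rV[R]_N, exists f,
     \sum_j c 0 j * x 0 j <= \sum_j c 0 j * v f 0 j) ->
  forall k, exists2 s : seq F, size s = k &
    \sum_j `|\sum_(f <- s) v f 0 j - k%:R * x 0 j| `^ q <= k%:R * (32 * D).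
Proof.
move=> vD hull.
(* Testing the hull condition on the gradient at x lets x inherit the bound D by convexity. *)
have xD : \sum_j `|x 0 j| `^ q <= D.
  have [f hf] := hull (\row_j powR_slope (x 0 j)).
  apply: le_trans (vD f).
  have : \sum_j (`|x 0 j| `^ q + powR_slope (x 0 j) * (v f 0 j - x 0 j)) <=
      \sum_j `|v f 0 j| `^ q.
    apply: ler_sum => j _; apply: le_trans (powR_add_ge _ _) _.
    by rewrite addrC subrK.
  rewrite big_split/=; apply: le_trans; rewrite lerDl.
  under eq_bigr do rewrite mulrBr.
  rewrite sumrB subr_ge0; move: hf.
  by under eq_bigr do rewrite mxE; under [leRHS]eq_bigr do rewrite mxE.
elim=> [|k [s ss IH]].
  exists [::] => //; rewrite mul0r big1// => j _.
  by rewrite big_nil mul0r subr0 normr0 powR0// lt0r_neq0.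
pose S j := \sum_(f <- s) v f 0 j - k%:R * x 0 j.
have [f hf] := hull (\row_j - powR_slope (S j)).
exists (rcons s f); first by rewrite size_rcons ss.
have -> : \sum_j `|\sum_(f <- rcons s f) v f 0 j - k.+1%:R * x 0 j| `^ q =
    \sum_j `|S j + (v f 0 j - x 0 j)| `^ q.
  apply: eq_bigr => j _; congr (`|_| `^ _).
  by rewrite big_rcons/= /S -natr1; ring.
(* The 4 of [powR_add_le], the 4 of [powR_add_le4] and D + D make up the 32 D of one step. *)
apply: (@le_trans _ _ (\sum_j (`|S j| `^ q + powR_slope (S j) * (v f 0 j - x 0 j)
    + 4 * (4 * (`|v f 0 j| `^ q + `|x 0 j| `^ q))))).
  apply: ler_sum => j _; apply: le_trans (powR_add_le _ _) _.
  rewrite lerD2l ler_wpM2l//; apply: le_trans (powR_add_le4 _ _) _.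
  by rewrite normrN.
rewrite !big_split/= -!mulr_sumr big_split/=.
have h1 : \sum_j powR_slope (S j) * (v f 0 j - x 0 j) <= 0.
  under eq_bigr do rewrite mulrBr.
  rewrite sumrB subr_le0; move: hf.
  under eq_bigr do rewrite mxE mulNr; under [leRHS]eq_bigr do rewrite mxE mulNr.
  by rewrite !sumrN lerN2.
have h2 := vD f.
rewrite -natr1 mulrDl mul1r; rewrite /S in h1 *; lra.
Qed.

End empirical_method.

(** * Volume of a hull of finitely many points *)

Section hull_volume.
Context {R : realType}.

(** The last hypothesis says through linear forms that K lies in lambda times the convex hull of v.
    By [maurey] each point of K is near one of the |F|^k averages in l_q, with relative error
    k^(1/q-1); the power mean inequality turns this into an l_1 distance of at most N t. *)
Lemma vol_hull N k (q lambda D : R) (F : finType) (v : F -> 'rV[R]_N)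
    (K : set 'rV[R]_N) :
  (0 < N)%N -> (0 < k)%N -> 1 <= q <= 2 -> 0 < lambda -> 1 <= D ->
  (forall f, \sum_j `|v f 0 j| `^ q <= D) ->
  (forall x, K x -> forall c : 'rV[R]_N, exists f,
     \sum_j c 0 j * x 0 j <= lambda * \sum_j c 0 j * v f 0 j) ->
  (vol K <= (#|F|%:R ^+ k * (2 * expR 1 * (lambda * (32 * D) *
     (N%:R `^ (- q^-1) * k%:R `^ (q^-1 - 1)))) ^+ N)%:E)%E.
Proof.
move=> N0 k0 /andP[q1 q2] l0 D1 vD hull.
have N0R : 0 < N%:R :> R by rewrite ltr0n.
have k0R : 0 < k%:R :> R by rewrite ltr0n.
have q0 : 0 < q by exact: lt_le_trans q1.
set t := lambda * (32 * D) * _.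
have t0 : 0 < t by rewrite !mulr_gt0 ?powR_gt0//; lra.
have it0 : 0 < t^-1 by rewrite invr_gt0.
(* With rate 1/t and weight N, one centre within l_1 distance N t already contributes at least 1. *)
apply: le_trans (@vol_l1_mixture R N t^-1 (k.-tuple F) (fun=> N%:R)
  (fun s => \row_j (lambda / k%:R * \sum_(f <- s) v f 0 j)) K it0 _) _; last first.
  rewrite lee_fin sumr_const card_tuple -[_ *+ _]mulr_natr natrX invrK.
  rewrite -[in leLHS](mulr1 N%:R) expRM_natl mulrAC -exprMn mulrC.
  by rewrite [expR 1 * _]mulrCA mulrA.
move=> x Kx.
have [|s ss hs] := @maurey R q q1 q2 N F v (lambda^-1 *: x) D vD _ k.
  move=> c; have [f hf] := hull x Kx c; exists f.
  under eq_bigr do rewrite mxE mulrCA.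
  by rewrite -mulr_sumr mulrC ler_pdivrMr// mulrC.
have /eqP ss' := ss.
pose s' : k.-tuple F := Tuple ss'.
have e0 (i : k.-tuple F) : 0 <= expR (N%:R - t^-1 * \sum_j
  `|x 0 j - (\row_j (lambda / k%:R * \sum_(f <- i) v f 0 j)) 0 j|) by exact: expR_ge0.
rewrite (bigD1 s')//=; apply: ler_wpDr; first by apply: sumr_ge0 => i _; exact: e0.
rewrite -[leLHS]expR0 ler_expR subr_ge0 mulrC ler_pdivrMr//.
pose y : 'rV[R]_N := \row_j (x 0 j - lambda / k%:R * \sum_(f <- s) v f 0 j).
rewrite [leLHS](_ : _ = lp_norm 1%:E y); last first.
  rewrite /= invr1 powRr1; last by apply: sumr_ge0 => j _; exact: powR_ge0.
  by apply: eq_bigr => j _; rewrite !mxE powRr1.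
have yq : lp_norm q%:E y <= lambda / k%:R * (k%:R * (32 * D)) `^ q^-1.
  have lk0 : 0 <= lambda / k%:R by rewrite divr_ge0// ltW.
  have -> : y = (- (lambda / k%:R)) *:
      \row_j (\sum_(f <- s) v f 0 j - k%:R * (lambda^-1 *: x) 0 j).
    by apply/rowP => j; rewrite !mxE; field; rewrite !gt_eqF.
  rewrite lp_normZ// normrN ger0_norm// ler_wpM2l//=.
  apply: ge0_ler_powR; rewrite ?nnegrE ?invr_ge0 ?(ltW q0)//.
  - by apply: sumr_ge0 => j _; exact: powR_ge0.
  - by rewrite mulr_ge0 ?ler0n//; lra.
  by under eq_bigr do rewrite mxE.
apply: le_trans (@lp_norm_power_mean R N 1%:E q%:E y N0 _ _) _ => //.
rewrite !rexpE// invr1.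
apply: le_trans (ler_wpM2l (powR_ge0 _ _) yq) _.
(* The root may be dropped because 32 D >= 1. *)
have hD : (32 * D) `^ q^-1 <= 32 * D.
  by apply: ler1_powR; [lra|rewrite invf_le1].
rewrite powRM ?ler0n//; last lra.
apply: (@le_trans _ _ (N%:R `^ (1 - q^-1) * (lambda / k%:R * (k%:R `^ q^-1 * (32 * D))))).
  rewrite ler_wpM2l ?powR_ge0// ler_wpM2l ?divr_ge0 ?(ltW l0)//.
  by rewrite ler_wpM2l ?powR_ge0.
rewrite /t !powRB ?(lt0r_neq0 N0R) ?(lt0r_neq0 k0R) ?implybT// powRN !powRr1 ?ler0n//.
rewrite le_eqVlt; apply/orP; left; apply/eqP.
by field; rewrite !gt_eqF// powR_gt0.
Qed.

End hull_volume.

(** * Lattice nets for the l_q ball *)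

Section net.
Context {R : realType}.

(* An integer vector is coded by the absolute values and the signs of its
   entries. *)
Definition lattice_code n := {ffun 'I_n -> 'I_(8 * n).+1 * bool}.

Definition lattice_entry n (e : lattice_code n) (i : 'I_n) : R :=
  (-1) ^+ (e i).2 * (e i).1%:R.

(** The lattice is scaled by n^(1/q) in [net_vec]. The bound 8 n leaves room for rounding a scaled
    point of the unit ball: each |y_i| grows by at most 1, and 4 (n + n) = 8 n by [powR_add_le4]. *)
Definition net_set (q : R) n : {set lattice_code n} :=
  finset (fun e : lattice_code n => \sum_i ((e i).1%:R : R) `^ q <= (8 * n)%:R).

Definition net (q : R) n := {e : lattice_code n | e \in net_set q n}.

Definition net_vec (q : R) n (e : net q n) : 'rV[R]_n :=
  \row_i (lattice_entry (val e) i / n%:R `^ q^-1).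

Lemma norm_lattice_entry n (e : lattice_code n) i : `|lattice_entry e i| = (e i).1%:R.
Proof. by rewrite normrM normr_sign mul1r ger0_norm. Qed.

Lemma natr_le_powR (q : R) (m : nat) : 1 <= q -> m%:R <= m%:R `^ q.
Proof.
move=> q1; case: m => [|m]; first exact: powR_ge0.
by apply: le1r_powR => //; rewrite ler1n.
Qed.

Lemma sum_half_pow m : \sum_(i < m) (2^-1 : R) ^+ i <= 2.
Proof.
suff -> : \sum_(i < m) (2^-1 : R) ^+ i = 2 - 2 * 2^-1 ^+ m.
  have h : 0 <= (2^-1 : R) ^+ m by rewrite exprn_ge0// invr_ge0.
  lra.
elim: m => [|m IH]; first by rewrite big_ord0 expr0; lra.
by rewrite big_ord_recr/= IH exprS; lra.
Qed.

(** Counting by weights: the product of the 2^(-|m_i|) is at least 2^(-8n) on the net, because |m_i|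
    <= |m_i|^q, while its sum over all codes is at most 4^n, from two signs and a geometric series
    of sum at most 2 per entry. *)
Lemma card_net (q : R) n : 1 <= q -> #|{: net q n}|%:R <= (2 ^+ 8 * 4) ^+ n :> R.
Proof.
move=> q1; rewrite card_sig.
pose w (a : 'I_(8 * n).+1 * bool) : R := 2^-1 ^+ a.1.
have w0 a : 0 <= w a by rewrite exprn_ge0// invr_ge0.
have h2 : 0 < (2 : R) ^+ (8 * n) by rewrite exprn_gt0.
apply: (@le_trans _ _ (2 ^+ (8 * n) * \sum_(e : lattice_code n) \prod_i w (e i))).
  rewrite -sum1_card natr_sum mulr_sumr [leRHS](bigID (mem (net_set q n)))/=.
  rewrite -[leLHS]addr0 lerD//; last first.
    by apply: sumr_ge0 => e _; rewrite mulr_ge0 ?(ltW h2)// prodr_ge0.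
  apply: ler_sum => e; rewrite inE => he.
  have se : (\sum_i (e i).1 <= 8 * n)%N.
    rewrite -(ler_nat R) natr_sum; apply: le_trans he.
    by apply: ler_sum => i _; exact: natr_le_powR.
  have -> : \prod_i w (e i) = 2^-1 ^+ (\sum_i (e i).1)%N.
    by rewrite /w; elim/big_rec2: _ => [|i a b _ ->]; rewrite ?expr0// exprD.
  rewrite exprVn mulrC ler_pdivlMl ?exprn_gt0// mulr1.
  by rewrite ler_eXn2l// ltr1n.
rewrite -(bigA_distr_bigA (fun (_ : 'I_n) a => w a)) prodr_const card_ord.
have sw : \sum_a w a <= 4.
  rewrite -(pair_bigA _ (fun (i : 'I_(8 * n).+1) (_ : bool) => (2^-1 : R) ^+ i))/=.
  under eq_bigr do rewrite sumr_const card_bool.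
  rewrite sumrMnl; apply: (@le_trans _ _ (2 *+ 2)); last by rewrite -mulrnA.
  by rewrite lerMn2r sum_half_pow orbT.
apply: (@le_trans _ _ (2 ^+ (8 * n) * 4 ^+ n)).
  rewrite ler_wpM2l ?(ltW h2)//; apply: lerXn2r; rewrite ?nnegrE//.
  by apply: sumr_ge0 => a _; exact: w0.
by rewrite exprM -exprMn.
Qed.

Lemma net_vec_norm (q : R) n (e : net q n) : (0 < n)%N -> 1 <= q ->
  \sum_i `|net_vec e 0 i| `^ q <= 8.
Proof.
move=> n0 q1; have q0 : 0 < q by exact: lt_le_trans q1.
have n0R : 0 < n%:R :> R by rewrite ltr0n.
have ee := valP e; rewrite inE in ee.
under eq_bigr => i _.
  rewrite mxE normrM norm_lattice_entry normfV (ger0_norm (powR_ge0 _ _)).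
  rewrite powRM ?invr_ge0 ?powR_ge0// -powRN -powRrM.
  rewrite mulNr mulVf ?lt0r_neq0// powR_inv1 ?ler0n//.
  over.
rewrite -mulr_suml ler_pdivrMr// -natrM; exact: ee.
Qed.

(* The entries are rounded up or down, whichever increases the value of the
   linear form. *)
Lemma net_vec_dominates (q : R) n (x c : 'rV[R]_n) :
  (0 < n)%N -> 1 <= q <= 2 -> lp_norm q%:E x <= 1 ->
  exists e : net q n, \sum_i c 0 i * x 0 i <= \sum_i c 0 i * net_vec e 0 i.
Proof.
move=> n0 /andP[q1 q2]; have q0 : 0 < q by exact: lt_le_trans q1.
have n0R : 0 < n%:R :> R by rewrite ltr0n.
pose h := n%:R `^ q^-1 : R.
have h0 : 0 < h by exact: powR_gt0.
move=> x1.
have {}x1 : \sum_i `|x 0 i| `^ q <= 1.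
  have s0 : 0 <= \sum_i `|x 0 i| `^ q by apply: sumr_ge0 => i _; exact: powR_ge0.
  rewrite -[leLHS]powRr1// -[in leLHS](mulVf (lt0r_neq0 q0)) powRrM.
  rewrite [leRHS](_ : 1 = 1 `^ q); last by rewrite powR1.
  by apply: ge0_ler_powR; rewrite ?nnegrE ?powR_ge0//; exact: ltW.
pose y i := h * x 0 i.
pose m i : nat := if (0 <= c 0 i) == (0 <= y i) then (Num.truncn `|y i|).+1
  else Num.truncn `|y i|.
have my i : (m i)%:R <= `|y i| + 1.
  rewrite /m; case: ifP => _; rewrite -?natr1 ?lerD2r.
    by rewrite truncn_le.
  by apply: (@le_trans _ _ `|y i|); [rewrite truncn_le|rewrite lerDl].
have sm : \sum_i (m i)%:R `^ q <= (8 * n)%:R :> R.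
  apply: (@le_trans _ _ (\sum_i 4 * (n%:R * `|x 0 i| `^ q + 1))).
    apply: ler_sum => i _.
    apply: (@le_trans _ _ ((`|y i| + 1) `^ q)).
      by apply: ge0_ler_powR; rewrite ?nnegrE ?addr_ge0 ?ler0n ?(ltW q0).
    have := powR_add_le4 q1 q2 `|y i| 1.
    rewrite ger0_norm ?addr_ge0// normr1 powR1 normr_id /y normrM (gtr0_norm h0).
    by rewrite powRM ?(ltW h0)// -powRrM mulVf ?lt0r_neq0// powRr1 ?ler0n.
  rewrite -mulr_sumr big_split/= -mulr_sumr sumr_const card_ord natrM.
  have : n%:R * \sum_i `|x 0 i| `^ q <= n%:R * 1 by rewrite ler_wpM2l ?ler0n.
  lra.
have mlt i : (m i < (8 * n).+1)%N.
  rewrite ltnS -(ler_nat R); apply: le_trans sm.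
  apply: le_trans (natr_le_powR (m i) q1) _.
  by rewrite (bigD1 i)//= lerDl; apply: sumr_ge0 => j _; exact: powR_ge0.
pose e0 : lattice_code n := [ffun i => (Ordinal (mlt i), y i < 0)].
have e0P : e0 \in net_set q n.
  by rewrite inE; under eq_bigr do rewrite ffunE.
exists (exist _ e0 e0P); apply: ler_sum => i _.
rewrite mxE /lattice_entry/= ffunE/=.
rewrite -(ler_pM2l h0) mulrCA -/(y i) [leRHS]mulrCA [h * _]mulrC divfK ?lt0r_neq0//.
have ly : `|y i| < (Num.truncn `|y i|).+1%:R by exact: truncnS_gt.
have ty : (Num.truncn `|y i|)%:R <= `|y i| by rewrite truncn_le.
rewrite /m [0 <= y i]leNgt [0 <= c 0 i]leNgt.
have [yi|yi] := ltP (y i) 0; [rewrite ltr0_norm// in ly ty *|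
  rewrite ger0_norm// in ly ty *]; have [ci|ci] := ltP (c 0 i) 0;
  rewrite ?expr1 ?expr0 ?mulN1r ?mul1r.
- by rewrite ler_wnM2l ?(ltW ci)// lerNl; exact: ltW.
- by rewrite ler_wpM2l// lerNr.
- by rewrite ler_wnM2l ?(ltW ci).
- by rewrite ler_wpM2l// ltW.
Qed.

End net.

(** * Volume of a hull of elementary tensors *)

Section tensor_hull.
Context {R : realType}.

(** The cube counts the points of the three nets, 2 e comes from integrating the exponentials, 32
    from [maurey], and 8 * 8 * 8 bounds the q-th power of the l_q norm of a tensor of net points. *)
Definition volume_const : R := (2 ^+ 8 * 4) ^+ 3 * (2 * expR 1 * (32 * (8 * 8 * 8))).

Lemma volume_const_gt0 : 0 < volume_const.
Proof. by rewrite !mulr_gt0// ?exprn_gt0 ?expR_gt0. Qed.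

(** Applies [vol_hull] with k = n m samples: at most b^(3n) tensors of net points then give b^(3n *
    n m) = b^(3N) centres for N = n n m, a constant after the N-th root. *)
Lemma vol_tensor_hull n m (q lambda : R) (K : set 'rV[R]_(n * n * m)) :
  (0 < m <= n)%N -> 1 <= q <= 2 -> 0 < lambda ->
  (forall A, K A -> forall c : 'rV[R]_(n * n * m), exists x y z,
     [/\ lp_norm q%:E x <= 1, lp_norm q%:E y <= 1, lp_norm q%:E z <= 1 &
     \sum_a c 0 a * A 0 a <= lambda * \sum_a c 0 a * tens x y z 0 a]) ->
  (vol K <= ((volume_const * lambda * n%:R `^ (- (1 + q^-1)) / m%:R)
     ^+ (n * n * m))%:E)%E.
Proof.
move=> /andP[m0 mn] q12 l0 hK; have /andP[q1 q2] := q12.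
have n0 : (0 < n)%N by exact: leq_trans mn.
have n0R : 0 < n%:R :> R by rewrite ltr0n.
have m0R : 0 < m%:R :> R by rewrite ltr0n.
have q0 : 0 < q by exact: lt_le_trans q1.
pose F : finType := (net q n * net q n * net q m)%type.
pose v (f : F) := tens (net_vec f.1.1) (net_vec f.1.2) (net_vec f.2).
have vD f : \sum_a `|v f 0 a| `^ q <= 8 * 8 * 8.
  rewrite sum_idx3.
  under eq_bigr => i _ do under eq_bigr => j _ do under eq_bigr => k _ do
    rewrite tensE !normrM !powRM ?mulr_ge0//.
  under eq_bigr => i _ do under eq_bigr => j _ do rewrite -mulr_sumr.
  under eq_bigr => i _ do rewrite -mulr_suml -mulr_sumr.
  rewrite -!mulr_suml.
  have s0 d (x : 'rV[R]_d) : 0 <= \sum_i `|x 0 i| `^ q.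
    by apply: sumr_ge0 => i _; exact: powR_ge0.
  by rewrite !ler_pM ?mulr_ge0// net_vec_norm.
have hull A : K A -> forall c : 'rV[R]_(n * n * m), exists f,
    \sum_a c 0 a * A 0 a <= lambda * \sum_a c 0 a * v f 0 a.
  move=> KA c; have [x [y [z [x1 y1 z1 hA]]]] := hK A KA c.
  (* The form is linear in each factor with the other two fixed, so the factors are moved into the
     nets one at a time without decreasing its value. *)
  pose cx : 'rV[R]_n := \row_i \sum_j \sum_k c 0 (idx3 i j k) * (y 0 j * z 0 k).
  have [e1 he1] := net_vec_dominates cx n0 q12 x1.
  pose x' := net_vec e1.
  pose cy : 'rV[R]_n := \row_j \sum_i \sum_k c 0 (idx3 i j k) * (x' 0 i * z 0 k).
  have [e2 he2] := net_vec_dominates cy n0 q12 y1.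
  pose y' := net_vec e2.
  pose cz : 'rV[R]_m := \row_k \sum_i \sum_j c 0 (idx3 i j k) * (x' 0 i * y' 0 j).
  have [e3 he3] := net_vec_dominates cz m0 q12 z1.
  exists (e1, e2, e3); apply: le_trans hA _; rewrite ler_wpM2l ?(ltW l0)//.
  have tE (x0 y0 : 'rV[R]_n) (z0 : 'rV[R]_m) : \sum_a c 0 a * tens x0 y0 z0 0 a =
      \sum_i \sum_j \sum_k c 0 (idx3 i j k) * (x0 0 i * y0 0 j * z0 0 k).
    by rewrite sum_idx3; do 3 (apply: eq_bigr => ? _); rewrite tensE.
  have xE (x0 : 'rV[R]_n) : \sum_i cx 0 i * x0 0 i = \sum_a c 0 a * tens x0 y z 0 a.
    rewrite tE; apply: eq_bigr => i _; rewrite mxE mulr_suml.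
    apply: eq_bigr => j _; rewrite mulr_suml; apply: eq_bigr => k _.
    by ring.
  have yE (y0 : 'rV[R]_n) : \sum_i cy 0 i * y0 0 i = \sum_a c 0 a * tens x' y0 z 0 a.
    rewrite tE exchange_big; apply: eq_bigr => j _; rewrite mxE mulr_suml.
    apply: eq_bigr => i _; rewrite mulr_suml; apply: eq_bigr => k _.
    by ring.
  have zE (z0 : 'rV[R]_m) : \sum_i cz 0 i * z0 0 i = \sum_a c 0 a * tens x' y' z0 0 a.
    rewrite tE; under [RHS]eq_bigr do rewrite exchange_big.
    rewrite exchange_big; apply: eq_bigr => k _; rewrite mxE mulr_suml.
    apply: eq_bigr => i _; rewrite mulr_suml; apply: eq_bigr => j _.
    by ring.
  rewrite !xE in he1; rewrite !yE in he2; rewrite !zE in he3.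
  exact: le_trans he1 (le_trans he2 he3).
have N0 : (0 < n * n * m)%N by rewrite !muln_gt0 n0 m0.
have k0 : (0 < n * m)%N by rewrite muln_gt0 n0 m0.
apply: le_trans (vol_hull N0 k0 q12 l0 _ vD hull) _.
  by rewrite !mulr_ege1 ?ler1n.
rewrite lee_fin.
set t := lambda * _ * _.
have tE : t = lambda * (32 * (8 * 8 * 8)) * (n%:R `^ (- (1 + q^-1)) / m%:R).
  rewrite /t; congr (_ * _).
  rewrite -mulnA natrM powRM ?ler0n// natrM.
  set N := n%:R * m%:R; have NR : 0 < N by rewrite mulr_gt0.
  rewrite -mulrA -powRD ?(lt0r_neq0 NR) ?implybT//.
  rewrite addrA addNr add0r powR_inv1 ?ltW// opprD powRD ?(lt0r_neq0 n0R) ?implybT//.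
  by rewrite powR_inv1 ?ler0n// /N invfM mulrA [_ * n%:R^-1]mulrC.
have t0 : 0 <= t by rewrite tE !mulr_ge0 ?powR_ge0 ?invr_ge0 ?ler0n ?(ltW l0).
pose b : R := 2 ^+ 8 * 4.
have b1 : 1 <= b by rewrite /b; apply: mulr_ege1; rewrite ?exprn_ege1 ?ler1n.
have b0 : 0 <= b by exact: le_trans b1.
have cF : #|F|%:R <= b ^+ (3 * n) :> R.
  rewrite !card_prod !natrM (_ : 3 * n = n + n + n)%N; last by lia.
  rewrite !exprD; apply: ler_pM; rewrite ?mulr_ge0 ?ler0n//.
    by apply: ler_pM; rewrite ?ler0n// card_net.
  apply: le_trans (card_net m q1) _; by rewrite ler_weXn2l.
apply: (@le_trans _ _ ((b ^+ (3 * n)) ^+ (n * m) * (2 * expR 1 * t) ^+ (n * n * m))).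
  rewrite ler_wpM2r//.
    by rewrite exprn_ge0// mulr_ge0// mulr_ge0// expR_ge0.
  by apply: lerXn2r; rewrite ?nnegrE ?ler0n ?exprn_ge0.
rewrite -exprM (_ : 3 * n * (n * m) = 3 * (n * n * m))%N; last by lia.
rewrite exprM -exprMn tE /volume_const le_eqVlt; apply/orP; left; apply/eqP.
congr (_ ^+ _); rewrite -/b; set D := 32 * _; set E := 2 * expR 1.
set P := n%:R `^ _; clearbody b D E P; ring.
Qed.

End tensor_hull.

(** * The norm of the identity *)

Section identity_norm.
Context {R : realType}.

Lemma lp_norm2_le N (x : 'rV[R]_N) (s : R) : 0 <= s ->
  (forall i, `|x 0 i| <= s) -> lp_norm 2%:E x <= Num.sqrt N%:R * s.
Proof.
move=> s0 xs.
rewrite -(ler_pXn2r (n := 2))// ?nnegrE ?lp_norm_ge0 ?mulr_ge0 ?sqrtr_ge0//.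
rewrite lp_norm2_sqr exprMn sqr_sqrtr ?ler0n//.
have -> : N%:R * s ^+ 2 = \sum_(i < N) s ^+ 2.
  by rewrite sumr_const card_ord mulr_natl.
apply: ler_sum => i _; rewrite -[leLHS]real_normK ?num_real//.
by apply: lerXn2r; rewrite ?nnegrE.
Qed.

Lemma vol_cube N (s : R) : 0 <= s ->
  vol [set x : 'rV[R]_N | forall i, `|x 0 i| <= s] = ((2 * s) ^+ N)%:E.
Proof.
move=> s0; have -> : (2 * s) ^+ N = \prod_(i < N)
    ((const_mx s : 'rV[R]_N) 0 i - (const_mx (- s) : 'rV[R]_N) 0 i).
  under eq_bigr do rewrite !mxE opprK -mulr2n -mulr_natl.
  by rewrite prodr_const card_ord.
rewrite -vol_box => [|i]; last by rewrite !mxE; lra.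
congr vol; apply/seteqP; split=> x /= h i; have := h i; rewrite !mxE.
  by rewrite ler_norml.
by rewrite ler_norml.
Qed.

Variables (p q r : \bar R) (n : nat).
Hypotheses (p1 : (1%:E <= p)%E) (pq : (p <= q)%E) (q2 : (q <= 2%:E)%E)
  (r2 : (2%:E <= r)%E) (n0 : (0 < n)%N).
Local Notation pn := (@proj_norm R n p q r).
Local Notation rho := (id_norm p q r n).
Local Notation C := (@volume_const R).

Let q1 : (1%:E <= q)%E. Proof. exact: le_trans pq. Qed.
Let r1 : (1%:E <= r)%E. Proof. by apply: le_trans r2; rewrite lee_fin ler1n. Qed.
Let n0R : 0 < n%:R :> R. Proof. by rewrite ltr0n. Qed.

Let powRn (e : R) : 0 < n%:R `^ e :> R. Proof. exact: powR_gt0. Qed.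
Let powRnD (a b : R) : n%:R `^ (a + b) = n%:R `^ a * n%:R `^ b :> R.
Proof. by rewrite powRD// (lt0r_neq0 n0R) implybT. Qed.

(** The factor 2 stands in for the attainment of a supremum: if the form stayed below half its value
    g at A on all products of unit vectors, then g > 0 and [proj_norm_dual] would give g <= g /
    2. *)
Lemma proj_norm_dominated (A c : 'rV[R]_(n * n * n)) : pn A <= 1 ->
  exists x y z, [/\ lp_norm p x <= 1, lp_norm q y <= 1, lp_norm r z <= 1 &
    \sum_a c 0 a * A 0 a <= 2 * \sum_a c 0 a * tensor3 x y z 0 a].
Proof.
move=> A1; apply: contrapT => H.
set g := \sum_a c 0 a * A 0 a.
have {}H x y z : lp_norm p x <= 1 -> lp_norm q y <= 1 -> lp_norm r z <= 1 ->
    \sum_a c 0 a * tensor3 x y z 0 a < g / 2.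
  move=> x1 y1 z1; rewrite ltNge; apply/negP => h; apply: H.
  by exists x, y, z; split => //; rewrite -/g -ler_pdivrMl// mulrC.
have tZ a b d x y z : \sum_l c 0 l * tensor3 (a *: x) (b *: y) (d *: z) 0 l =
    a * b * d * \sum_l c 0 l * tensor3 x y z 0 l.
  rewrite !sum_idx3 !mulr_sumr; apply: eq_bigr => i _.
  rewrite !mulr_sumr; apply: eq_bigr => j _; rewrite !mulr_sumr.
  by apply: eq_bigr => k _; rewrite [X in _ * X = _]tensE [X in _ = _ * (_ * X)]tensE !mxE; ring.
have N0 s : lp_norm s (0 : 'rV[R]_n) = 0 -> lp_norm s (0 : 'rV[R]_n) <= 1 by move=> ->.
have zero s : (1%:E <= s)%E -> lp_norm s (0 : 'rV[R]_n) = 0.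
  by move=> s1; rewrite -(scale0r (0 : 'rV[R]_n)) lp_normZ// normr0 mul0r.
have g0 : 0 < g.
  have := H 0 0 0 (N0 _ (zero _ p1)) (N0 _ (zero _ q1)) (N0 _ (zero _ r1)).
  by rewrite -(scale0r (0 : 'rV[R]_n)) tZ !mul0r; lra.
have : g <= g / 2 * pn A.
  apply: proj_norm_dual => //; first by rewrite divr_ge0// ltW.
  move=> x y z.
  have [x0|xn0] := eqVneq (lp_norm p x) 0.
    by rewrite x0 !mul0r mulr0 (lp_norm_eq0 p1 x0) -(scale0r x) -(scale1r y)
      -(scale1r z) tZ !mul0r.
  have [y0|yn0] := eqVneq (lp_norm q y) 0.
    by rewrite y0 mulr0 mul0r mulr0 (lp_norm_eq0 q1 y0) -(scale0r y)
      -(scale1r x) -(scale1r z) tZ mulr0 !mul0r.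
  have [z0|zn0] := eqVneq (lp_norm r z) 0.
    by rewrite z0 !mulr0 (lp_norm_eq0 r1 z0) -(scale0r z) -(scale1r x)
      -(scale1r y) tZ mulr0 !mul0r.
  have x0 : 0 < lp_norm p x by rewrite lt_neqAle eq_sym xn0 lp_norm_ge0.
  have y0 : 0 < lp_norm q y by rewrite lt_neqAle eq_sym yn0 lp_norm_ge0.
  have z0 : 0 < lp_norm r z by rewrite lt_neqAle eq_sym zn0 lp_norm_ge0.
  have := H ((lp_norm p x)^-1 *: x) ((lp_norm q y)^-1 *: y) ((lp_norm r z)^-1 *: z).
  rewrite !lp_normZ// !gtr0_norm ?invr_gt0// !mulVf//.
  move=> /(_ (lexx _) (lexx _) (lexx _)) /ltW; rewrite tZ -!invfM.
  by rewrite mulrC ler_pdivrMr// !mulr_gt0.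
rewrite mulrAC ler_pdivlMr// => h; nra.
Qed.

(** The Euclidean case of [vol_tensor_hull]: the l_p and l_q balls lie in the l_2 ball, and the l_r
    ball lies in its multiple by mu. *)
Lemma vol_ball_le :
  (vol (unit_ball pn) <=
    ((2 * C * n%:R `^ (- (2 + rexp r))) ^+ (n * n * n))%:E)%E.
Proof.
pose mu := n%:R `^ (2^-1 - rexp r) : R.
have mu0 : 0 < mu by exact: powRn.
have := @vol_tensor_hull R n n 2 (2 * mu) (unit_ball pn).
have e : C * (2 * mu) * n%:R `^ (- (1 + 2^-1)) / n%:R =
    2 * C * n%:R `^ (- (2 + rexp r)).
  rewrite -[n%:R^-1]powR_inv1 ?ler0n//.
  rewrite (_ : - (2 + rexp r) = (2^-1 - rexp r) + (- (1 + 2^-1)) + (-1)); last by lra.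
  by rewrite 2!powRnD -/mu; ring.
rewrite e; apply; rewrite ?n0 ?leqnn//; first by rewrite ler1n lexx.
  by rewrite mulr_gt0.
move=> A KA c; have [x [y [z [x1 y1 z1 hA]]]] := proj_norm_dominated c KA.
have p2 : (p <= 2%:E)%E by exact: le_trans pq q2.
exists x, y, (mu^-1 *: z); split.
- exact: le_trans (lp_norm_antitone x p1 p2) x1.
- exact: le_trans (lp_norm_antitone y q1 q2) y1.
- rewrite lp_normZ ?lee_fin ?ler1n// gtr0_norm ?invr_gt0// mulrC ler_pdivrMr// mul1r.
  have := @lp_norm_power_mean R n 2%:E r z n0 _ r2; rewrite rexpE ?ler1n//.
  move=> /(_ _)/le_trans; apply; first by rewrite lee_fin ler1n.
  by rewrite -[leRHS]mulr1 ler_wpM2l// ltW.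
apply: le_trans hA _; rewrite le_eqVlt; apply/orP; left; apply/eqP.
rewrite -mulrA; congr (_ * _); rewrite mulr_sumr; apply: eq_bigr => a _.
have [i [j [k ->]]] := idx3P a.
rewrite [X in _ * X = _]tensE [X in _ = _ * (_ * X)]tensE mxE.
by field; exact: lt0r_neq0.
Qed.

(** Each of the n^2 fibres has l_r norm at most n^(1/r) n^(-2-1/r) = n^(-2). *)
Lemma cube_sub_ball :
  [set A : 'rV[R]_(n * n * n) | forall a, `|A 0 a| <= n%:R `^ (- (2 + rexp r))] `<=` unit_ball pn.
Proof.
move=> A hA; rewrite /unit_ball/= [A]fiber_decomposition.
apply: le_trans (proj_norm_le _ _ _ _ _ _) _.
apply: (@le_trans _ _ (\sum_(ij : 'I_n * 'I_n) n%:R `^ (-2))).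
  apply: ler_sum => -[i j] _ /=; rewrite !lp_norm_delta// !mul1r.
  apply: le_trans (lp_norm_power_mean _ n0 r1 (leey r)) _.
  rewrite rexp_oo subr0 (_ : -2 = rexp r + (- (2 + rexp r))); last by lra.
  rewrite powRnD ler_wpM2l ?(ltW (powRn _))//=.
  elim/big_ind: _ => [|a b a1 b1|k _]; first exact: ltW.
    by rewrite ge_max a1.
  by rewrite mxE; exact: hA.
rewrite sumr_const card_prod card_ord -[_ *+ _]mulr_natr natrM.
by rewrite powRN powR_mulrn ?ler0n// -expr2 mulVf// expf_neq0// lt0r_neq0.
Qed.

Lemma vol_ball_ge :
  (((2 * n%:R `^ (- (2 + rexp r))) ^+ (n * n * n))%:E <= vol (unit_ball pn))%E.
Proof.
by rewrite -vol_cube ?(ltW (powRn _))//; apply: vol_le; exact: cube_sub_ball.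
Qed.

Lemma proj_norm_le_id (A : 'rV[R]_(n * n * n)) : pn A <= rho * lp_norm 2%:E A.
Proof.
have := lp_norm_ge0 2%:E A; rewrite le_eqVlt => /predU1P[/esym A0|A0].
  have -> : A = 0 by apply: lp_norm_eq0 A0; rewrite lee_fin ler1n.
  rewrite -(scale0r (0 : 'rV[R]_(n * n * n))).
  apply: le_trans (proj_normZ q r p1 _ _) _.
  by rewrite lp_normZ ?lee_fin ?ler1n// normr0 !mul0r mulr0.
suff : pn ((lp_norm 2%:E A)^-1 *: A) <= rho.
  have := proj_normZ q r p1 (lp_norm 2%:E A) ((lp_norm 2%:E A)^-1 *: A).
  rewrite scalerA divff ?lt0r_neq0// scale1r gtr0_norm// => /le_trans h1 h2.
  by apply: h1; rewrite mulrC ler_wpM2r// ltW.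
apply: sup_upper_bound.
  split; first by exists (pn 0), 0 => //; rewrite /unit_ball/= -[leLHS]/(lp_norm 2%:E _)
    -(scale0r (0 : 'rV[R]_(n * n * n))) lp_normZ ?lee_fin ?ler1n// normr0 mul0r.
  (* The supremum is an upper bound only for a set bounded above; the bound n shows this. *)
  exists n%:R => _ [B B1 <-]; apply: le_trans (proj_norm_le_dim p1 q1 r2 B) _.
  by rewrite ler_piMr// ler0n.
exists ((lp_norm 2%:E A)^-1 *: A) => //; rewrite /unit_ball/=.
by rewrite -[leLHS]/(lp_norm 2%:E _) lp_normZ ?lee_fin ?ler1n// gtr0_norm ?invr_gt0//
  mulVf// lt0r_neq0.
Qed.

Lemma id_norm_le (M : R) : 0 <= M -> (forall A, pn A <= M * lp_norm 2%:E A) ->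
  rho <= M.
Proof.
move=> M0 h; apply: ge_sup.
  exists (pn 0), 0 => //; rewrite /unit_ball/= -[leLHS]/(lp_norm 2%:E _).
  by rewrite -(scale0r (0 : 'rV[R]_(n * n * n))) lp_normZ ?lee_fin ?ler1n// normr0 mul0r.
move=> _ [A A1 <-]; apply: le_trans (h A) _.
by rewrite -[leRHS]mulr1 ler_wpM2l.
Qed.

Lemma id_norm_upper : rho <= n%:R `^ Num.min (rexp q + rexp r) 1.
Proof.
apply: id_norm_le => [|A]; first exact: ltW.
case: (leP (rexp q + rexp r) 1) => h.
  exact: proj_norm_le_sign.
by rewrite powRr1 ?ler0n//; exact: proj_norm_le_dim.
Qed.

End identity_norm.

(** * Lower bounds for the norm of the identity *)

Section identity_norm_lower.
Context {R : realType}.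
Variables (p q r : \bar R) (n : nat).
Hypotheses (p1 : (1%:E <= p)%E) (pq : (p <= q)%E) (q2 : (q <= 2%:E)%E)
  (r2 : (2%:E <= r)%E) (n0 : (0 < n)%N).
Local Notation pn := (@proj_norm R n p q r).
Local Notation rho := (id_norm p q r n).
Local Notation C := (@volume_const R).

Let q1 : (1%:E <= q)%E. Proof. exact: le_trans pq. Qed.
Let r1 : (1%:E <= r)%E. Proof. by apply: le_trans r2; rewrite lee_fin ler1n. Qed.
Let n0R : 0 < n%:R :> R. Proof. by rewrite ltr0n. Qed.
Let powRn (e : R) : 0 < n%:R `^ e :> R. Proof. exact: powR_gt0. Qed.
Let powRnD (a b : R) : n%:R `^ (a + b) = n%:R `^ a * n%:R `^ b :> R.
Proof. by rewrite powRD// (lt0r_neq0 n0R) implybT. Qed.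
Let N0 : (0 < n * n * n)%N. Proof. by rewrite !muln_gt0 n0. Qed.

(** A coordinate form is at most 1 on tensors of unit vectors, so a basis tensor has projective norm
    at least 1. *)
Lemma id_norm_gt0 : 0 < rho.
Proof.
pose i0 : 'I_n := Ordinal n0.
pose e : 'rV[R]_(n * n * n) := delta_mx 0 (idx3 i0 i0 i0).
have e1 : \sum_a e 0 a * e 0 a = 1.
  rewrite (bigD1 (idx3 i0 i0 i0))//= big1 => [|a /negbTE ha].
    by rewrite mxE !eqxx mulr1 addr0.
  by rewrite mxE ha andbF mulr0.
have : \sum_a e 0 a * e 0 a <= 1 * pn e.
  apply: proj_norm_dual => // x y z; rewrite mul1r.
  rewrite (bigD1 (idx3 i0 i0 i0))//= big1 => [|a /negbTE ha]; last first.
    by rewrite mxE ha andbF mul0r.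
  rewrite addr0 [e _ _]mxE !eqxx mul1r [leLHS]tensE.
  apply: le_trans (ler_norm _) _; rewrite !normrM.
  by rewrite !ler_pM ?mulr_ge0// ler_lp_norm.
rewrite e1 mul1r => /le_trans-/(_ _ (proj_norm_le_id p1 pq r2 e)).
rewrite lp_norm_delta ?lee_fin ?ler1n// mulr1; exact: lt_le_trans.
Qed.

Lemma cube_sub_id_ball (s : R) (A : 'rV[R]_(n * n * n)) : 0 <= s ->
  (forall a, `|A 0 a| <= s) -> pn A <= rho * (n%:R `^ (2^-1 + 1) * s).
Proof.
move=> s0 hA; apply: le_trans (proj_norm_le_id p1 pq r2 A) _.
rewrite ler_wpM2l ?(ltW id_norm_gt0)//.
apply: le_trans (lp_norm2_le s0 hA) _; rewrite ler_wpM2r//.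
rewrite natrM natrM sqrtrM ?mulr_ge0 ?ler0n// -expr2 sqrtr_sqr ger0_norm ?ler0n//.
by rewrite powRnD powRr1 ?ler0n// -powR12_sqrt ?ler0n// mulrC.
Qed.

(** The ball of radius 1/rho is replaced by its inscribed cube of half-side n^(-3/2) / rho, whose
    volume is explicit and whose N-th root has the same order. *)
Lemma id_norm_ge_volume : n%:R `^ (2^-1 + rexp r) <= C * rho.
Proof.
have r0 := id_norm_gt0; have r00 := ltW r0.
pose s := (n%:R `^ (2^-1 + 1))^-1 / rho.
have s0 : 0 <= s by rewrite divr_ge0// invr_ge0 powR_ge0.
have : (((2 * s) ^+ (n * n * n))%:E <=
    ((2 * C * n%:R `^ (- (2 + rexp r))) ^+ (n * n * n))%:E)%E.
  rewrite -vol_cube//; apply: le_trans (vol_ball_le p1 pq q2 r2 n0).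
  apply: vol_le => A hA; apply: le_trans (cube_sub_id_ball s0 hA) _.
  rewrite le_eqVlt; apply/orP; left; apply/eqP; rewrite /s.
  by field; rewrite !lt0r_neq0.
have C0 := @volume_const_gt0 R.
rewrite lee_fin ler_pXn2r// ?nnegrE; last 2 first.
- by rewrite mulr_ge0.
- by rewrite !mulr_ge0 ?powR_ge0// ltW.
rewrite -mulrA ler_pM2l// /s ler_pdivrMr// -[_^-1]mul1r ler_pdivrMr//.
move=> h; have : 1 <= C * rho * n%:R `^ (- (2^-1 + rexp r)).
  apply: le_trans h _; rewrite le_eqVlt; apply/orP; left; apply/eqP.
  rewrite (_ : - (2^-1 + rexp r) = 2^-1 + 1 + - (2 + rexp r)); last by lra.
  by rewrite [in RHS]powRnD; ring.
by rewrite powRN ler_pdivlMr// mul1r.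
Qed.

(* Compares volumes in the slice of the tensors whose third index is fixed. *)
Lemma id_norm_ge_slice : n%:R `^ rexp q <= C * rho.
Proof.
have r0 := id_norm_gt0; have r00 := ltW r0.
have [s qE s1] : exists2 s, q = s%:E & 1 <= s <= 2.
  case/rexp_ge1: q1 => [[s qs s1]|qoo]; last by move: q2; rewrite qoo.
  by exists s => //; rewrite s1/= -lee_fin -qs.
pose i0 : 'I_n := Ordinal n0.
pose emb (A : 'rV[R]_(n * n * 1)) : 'rV[R]_(n * n * n) :=
  \sum_i \sum_j A 0 (idx3 i j 0) *: delta_mx 0 (idx3 i j i0).
have embE A i j k : emb A 0 (idx3 i j k) = A 0 (idx3 i j 0) * (k == i0)%:R.
  rewrite summxE (bigD1 i)//= [X in _ + X]big1 => [|i' ii']; last first.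
    rewrite summxE big1// => j' _; rewrite !mxE idx3_inj eqxx [i == _]eq_sym.
    by rewrite (negbTE ii') mulr0.
  rewrite addr0 summxE (bigD1 j)//= [X in _ + X]big1 => [|j' jj']; last first.
    by rewrite !mxE idx3_inj [j == _]eq_sym (negbTE jj') andbF mulr0.
  by rewrite !mxE idx3_inj !eqxx addr0.
have emb_pair c (A : 'rV[R]_(n * n * n)) : \sum_a emb c 0 a * A 0 a =
    \sum_i \sum_j c 0 (idx3 i j 0) * A 0 (idx3 i j i0).
  rewrite sum_idx3; apply: eq_bigr => i _; apply: eq_bigr => j _.
  rewrite (bigD1 i0)//= big1 => [|k /negbTE k0]; last by rewrite embE k0 mulr0 mul0r.
  by rewrite embE eqxx mulr1 addr0.
pose K := [set A : 'rV[R]_(n * n * 1) | pn (emb A) <= 1].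
have volK := @vol_tensor_hull R n 1 s 2 K.
(* The half-side of the cube inscribed in the Euclidean ball of radius 1/rho of the slice, which has
   dimension n^2. *)
pose t := n%:R^-1 / rho.
have t0 : 0 <= t by rewrite divr_ge0// invr_ge0 ler0n.
have cubeK : [set A : 'rV[R]_(n * n * 1) | forall a, `|A 0 a| <= t] `<=` K.
  move=> A hA; rewrite /K/=.
  apply: le_trans (proj_norm_le_id p1 pq r2 _) _.
  have -> : lp_norm 2%:E (emb A) = lp_norm 2%:E A.
    apply/eqP; rewrite -(@eqrXn2 _ 2) ?lp_norm_ge0// !lp_norm2_sqr.
    apply/eqP; under eq_bigr do rewrite expr2.
    rewrite emb_pair sum_idx3; apply: eq_bigr => i _; apply: eq_bigr => j _.
    by rewrite big_ord1 embE eqxx mulr1 expr2.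
  apply: le_trans (ler_wpM2l r00 (lp_norm2_le t0 hA)) _.
  rewrite muln1 natrM -expr2 sqrtr_sqr ger0_norm ?ler0n// /t.
  rewrite le_eqVlt; apply/orP; left; apply/eqP.
  by field; rewrite !lt0r_neq0.
have : (((2 * t) ^+ (n * n * 1))%:E <=
    ((C * 2 * n%:R `^ (- (1 + s^-1)) / 1%:R) ^+ (n * n * 1))%:E)%E.
  rewrite -vol_cube//; apply: le_trans (vol_le cubeK) _; apply: volK => //.
  move=> A KA c; have [x [y [z [x1 y1 z1 h]]]] := proj_norm_dominated p1 pq r2 (emb c) KA.
  (* A form supported on the slice sees only the entry of z at i0, which is bounded by the l_r norm
     of z. *)
  exists x, y, (\row__ z 0 i0); split.
  - by rewrite -qE; exact: le_trans (lp_norm_antitone x p1 pq) x1.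
  - by rewrite -qE.
  - rewrite -qE; apply: le_trans z1.
    have q1' := q1; have e1 : lp_norm q (\row_(_ < 1) z 0 i0) = `|z 0 i0|.
      have -> : (\row_(_ < 1) z 0 i0) = z 0 i0 *: delta_mx 0 0.
        by apply/rowP => i; rewrite ord1 !mxE eqxx mulr1.
      by rewrite lp_normZ// lp_norm_delta// mulr1.
    by rewrite e1; exact: ler_lp_norm.
  move: h; rewrite !emb_pair !sum_idx3 => h.
  apply: le_trans (le_trans _ h) _; rewrite le_eqVlt; apply/orP; left; apply/eqP.
    apply: eq_bigr => i _; apply: eq_bigr => j _.
    by rewrite big_ord1 embE eqxx mulr1.
  congr (_ * _); apply: eq_bigr => i _; apply: eq_bigr => j _.
  by rewrite big_ord1 [X in _ * X = _]tensE [X in _ = _ * X]tensE mxE.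
have C0 := @volume_const_gt0 R.
rewrite lee_fin ler_pXn2r ?muln1 ?muln_gt0 ?n0// ?nnegrE; last 2 first.
- by rewrite mulr_ge0.
- by rewrite divr1 !mulr_ge0 ?powR_ge0// ltW.
rewrite divr1 [C * 2]mulrC -mulrA ler_pM2l// /t ler_pdivrMr//.
rewrite -[_^-1]mul1r ler_pdivrMr// => h.
have : 1 <= C * rho * n%:R `^ (- s^-1).
  apply: le_trans h _; rewrite le_eqVlt; apply/orP; left; apply/eqP.
  rewrite opprD powRnD powR_inv1 ?ler0n//.
  by field; exact: lt0r_neq0.
case/andP: s1 => s1 _.
by rewrite powRN ler_pdivlMr// mul1r qE rexpE.
Qed.

(** As a form, B is the product of the sum of the x_i and the sum of the y_j z_j, of norm at most M
    since p = 1. Pairing B with itself gives n^2 <= M rho n, because B has Euclidean norm n. *)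
Lemma id_norm_ge_diagonal : p = 1%:E ->
  n%:R `^ Num.min (rexp q + rexp r) 1 <= rho.
Proof.
move=> pE; pose M := n%:R `^ (Num.max 0 (1 - rexp q - rexp r)) : R.
have M0 : 0 < M by exact: powRn.
pose B : 'rV[R]_(n * n * n) := \sum_i \sum_j delta_mx 0 (idx3 i j j).
have BE i j k : B 0 (idx3 i j k) = (k == j)%:R.
  rewrite summxE (bigD1 i)//= [X in _ + X]big1 => [|i' ii']; last first.
    rewrite summxE big1// => j' _; rewrite !mxE idx3_inj eqxx [i == _]eq_sym.
    by rewrite (negbTE ii').
  rewrite addr0 summxE (bigD1 j)//= [X in _ + X]big1 => [|j' jj']; last first.
    by rewrite !mxE idx3_inj [j == _]eq_sym (negbTE jj') andbF.
  by rewrite !mxE idx3_inj !eqxx addr0.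
have Bpair (A : 'rV[R]_(n * n * n)) : \sum_a B 0 a * A 0 a = \sum_i \sum_j A 0 (idx3 i j j).
  rewrite sum_idx3; apply: eq_bigr => i _; apply: eq_bigr => j _.
  rewrite (bigD1 j)//= big1 => [|k /negbTE kj]; last by rewrite BE kj mul0r.
  by rewrite BE eqxx mul1r addr0.
have BB : \sum_a B 0 a * B 0 a = n%:R * n%:R.
  rewrite Bpair; under eq_bigr do under eq_bigr do rewrite BE eqxx.
  by rewrite !(sumr_const, card_ord) mulr_natr.
have B2 : lp_norm 2%:E B = n%:R.
  apply/eqP; rewrite -(@eqrXn2 _ 2) ?lp_norm_ge0 ?ler0n// lp_norm2_sqr.
  by under eq_bigr do rewrite expr2; rewrite BB expr2.
have : \sum_a B 0 a * B 0 a <= M * pn B.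
  apply: proj_norm_dual; first exact: ltW.
  move=> x y z; rewrite Bpair.
  apply: (@le_trans _ _ (\sum_i `|x 0 i| * \sum_j `|y 0 j * z 0 j|)).
    apply: ler_sum => i _; rewrite mulr_sumr; apply: ler_sum => j _.
    by rewrite [leLHS]tensE -normrM mulrA ler_norm.
  rewrite -mulr_suml.
  have -> : \sum_i `|x 0 i| = lp_norm p x.
    rewrite pE /= invr1 powRr1; last by apply: sumr_ge0 => i _; exact: powR_ge0.
    by apply: eq_bigr => i _; rewrite powRr1.
  rewrite -mulrA mulrCA ler_wpM2l ?lp_norm_ge0// mulrA.
  exact: lp_pairing.
rewrite BB => /le_trans-/(_ _ (ler_wpM2l (ltW M0) (proj_norm_le_id p1 pq r2 B))).
rewrite B2 mulrA ler_pM2r// => h.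
rewrite (_ : Num.min _ _ = 1 - Num.max 0 (1 - rexp q - rexp r)); last first.
  by case: (leP (rexp q + rexp r) 1) => h1; [rewrite max_r|rewrite max_l]; lra.
rewrite powRnD powRN powRr1 ?ler0n// ler_pdivrMr// mulrC.
exact: h.
Qed.

End identity_norm_lower.

(** * Maximal volume ellipsoid and volume ratio *)

Section symmetries.
Context {R : realType} (n' : nat).
Local Notation n := n'.+1.
Local Notation N := (n * n * n)%N.

(** Signs and cyclic shifts for each factor. Only averages are formed, so an index set is enough;
    the dimension is a successor to give ['I_n] its cyclic addition. *)
Definition symmetry : finType :=
  (({ffun 'I_n -> bool} * {ffun 'I_n -> bool} * {ffun 'I_n -> bool}) *
   ('I_n * 'I_n * 'I_n))%type.
Implicit Types (g : symmetry) (A u : 'rV[R]_N).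

Definition coord1 (a : 'I_N) : 'I_n := (mxtens_unindex (mxtens_unindex a).1).1.
Definition coord2 (a : 'I_N) : 'I_n := (mxtens_unindex (mxtens_unindex a).1).2.
Definition coord3 (a : 'I_N) : 'I_n := (mxtens_unindex a).2.

Lemma coord1E i j k : coord1 (idx3 i j k) = i.
Proof. by rewrite /coord1 /idx3 !mxtens_indexK. Qed.

Lemma coord2E i j k : coord2 (idx3 i j k) = j.
Proof. by rewrite /coord2 /idx3 !mxtens_indexK. Qed.

Lemma coord3E i j k : coord3 (idx3 i j k) = k.
Proof. by rewrite /coord3 /idx3 !mxtens_indexK. Qed.

Definition sym_sign g (a : 'I_N) : R :=
  (-1) ^+ g.1.1.1 (coord1 a) * (-1) ^+ g.1.1.2 (coord2 a) *
  (-1) ^+ g.1.2 (coord3 a).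

Definition sym_shift (s : 'I_n * 'I_n * 'I_n) (a : 'I_N) : 'I_N :=
  idx3 (coord1 a + s.1.1) (coord2 a + s.1.2) (coord3 a + s.2).

Lemma sym_shift_inj s : injective (sym_shift s).
Proof.
move=> a b; have [i [j [k ->]]] := idx3P a; have [i' [j' [k' ->]]] := idx3P b.
rewrite /sym_shift !coord1E !coord2E !coord3E => /eqP; rewrite !idx3_inj.
by move=> /and3P[/eqP/addIr-> /eqP/addIr-> /eqP/addIr->].
Qed.

Lemma norm_sym_sign g a : `|sym_sign g a| = 1.
Proof. by rewrite !normrM !normrX !normrN !normr1 !expr1n !mulr1. Qed.

Definition sym_mx g : 'M[R]_N :=
  \matrix_(b, a) (sym_sign g a * (b == sym_shift g.2 a)%:R).

Lemma mul_sym_mxE g A a : (A *m sym_mx g) 0 a = sym_sign g a * A 0 (sym_shift g.2 a).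
Proof.
rewrite !mxE (bigD1 (sym_shift g.2 a))//= big1 => [|b /negbTE hb].
  by rewrite !mxE eqxx mulr1 addr0 mulrC.
by rewrite !mxE hb !mulr0.
Qed.

Lemma mul_sym_mx_trE g A b :
  (A *m (sym_mx g)^T) 0 (sym_shift g.2 b) = sym_sign g b * A 0 b.
Proof.
rewrite !mxE (bigD1 b)//= big1 => [|a hb].
  by rewrite !mxE eqxx mulr1 addr0 mulrC.
by rewrite !mxE (inj_eq (@sym_shift_inj _)) eq_sym (negbTE hb) !mulr0.
Qed.

Lemma lp_norm_sym_tr g A : lp_norm 2%:E (A *m (sym_mx g)^T) = lp_norm 2%:E A.
Proof.
apply/esym/(@lp_norm_perm _ _ _ _ _ (sym_shift g.2)); first exact: sym_shift_inj.
by move=> b; rewrite mul_sym_mx_trE normrM norm_sym_sign mul1r.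
Qed.

(** On an elementary tensor a symmetry acts factor by factor through signed permutations, which
    preserve every l_p norm. *)
Lemma proj_norm_sym (p q r : \bar R) g A :
  proj_norm p q r (A *m sym_mx g) <= proj_norm p q r A.
Proof.
rewrite -[leRHS]mul1r; apply: proj_normM => // x y z.
pose act (e : {ffun 'I_n -> bool}) (s : 'I_n) (v : 'rV[R]_n) : 'rV[R]_n :=
  \row_i ((-1) ^+ e i * v 0 (i + s)).
have actN t e s v : lp_norm t (act e s v) = lp_norm t v.
  apply: (@lp_norm_perm _ _ _ _ _ (fun i => i + s)); first exact: addIr.
  by move=> i; rewrite mxE normrM normrX normrN normr1 expr1n mul1r.
have -> : tensor3 x y z *m sym_mx g = tensor3 (act g.1.1.1 g.2.1.1 x)
    (act g.1.1.2 g.2.1.2 y) (act g.1.2 g.2.2 z).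
  apply: rV_idx3P => i j k; rewrite mul_sym_mxE [X in _ * X]tensE [RHS]tensE.
  by rewrite !mxE /sym_sign coord1E coord2E coord3E; ring.
by apply: le_trans (proj_norm_tensor _ _ _ _ _ _) _; rewrite !actN mul1r.
Qed.

Lemma sum_sym_sign (s : 'I_n * 'I_n * 'I_n) (a c : 'I_N) :
  \sum_(e : {ffun 'I_n -> bool} * {ffun 'I_n -> bool} * {ffun 'I_n -> bool})
    sym_sign (e, s) a * sym_sign (e, s) c = (a == c)%:R * (2 ^+ n) ^+ 3.
Proof.
rewrite -(pair_bigA _ (fun e12 e3 => sym_sign ((e12, e3), s) a *
  sym_sign ((e12, e3), s) c))/=.
rewrite -(pair_bigA _ (fun e1 e2 => \sum_e3 sym_sign (((e1, e2), e3), s) a *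
  sym_sign (((e1, e2), e3), s) c))/=.
have [i [j [k ->]]] := idx3P a; have [i' [j' [k' ->]]] := idx3P c.
rewrite /sym_sign/= !coord1E !coord2E !coord3E.
under eq_bigr => e1 _ do under eq_bigr => e2 _ do under eq_bigr => e3 _ do
  rewrite mulrACA [X in X * _]mulrACA.
under eq_bigr => e1 _ do under eq_bigr => e2 _ do
  rewrite -mulr_sumr sum_signs.
under eq_bigr => e1 _ do rewrite -mulr_suml -mulr_sumr sum_signs.
rewrite -!mulr_suml sum_signs idx3_inj !card_ord.
case: (i == i'); case: (j == j'); case: (k == k'); rewrite /= ?mulr0 ?mul0r//.
by rewrite mul1r; move: (2 ^+ n) => x; ring.
Qed.

(** Schur's lemma by hand: summing over the signs kills the off-diagonal entries of L, and the
    shifts carry a fixed index to each index exactly once, which leaves the trace. *)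
Lemma average_symmetries (L : 'M[R]_N) u :
  \sum_g (u *m (sym_mx g)^T *m L *m sym_mx g) = ((2 ^+ n) ^+ 3 * \tr L) *: u.
Proof.
apply/rowP => a; rewrite summxE mxE.
have E g : (u *m (sym_mx g)^T *m L *m sym_mx g) 0 a =
    \sum_c u 0 c * (sym_sign g a * sym_sign g c) *
      L (sym_shift g.2 c) (sym_shift g.2 a).
  rewrite mul_sym_mxE mxE mulr_sumr (reindex_inj (@sym_shift_inj g.2)).
  by apply: eq_bigr => c _; rewrite mul_sym_mx_trE; ring.
under eq_bigr do rewrite E.
rewrite -(pair_bigA _ (fun e s => \sum_c u 0 c *
  (sym_sign (e, s) a * sym_sign (e, s) c) * L (sym_shift s c) (sym_shift s a)))/=.
rewrite exchange_big/=.
under eq_bigr => s _.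
  rewrite exchange_big/=.
  under eq_bigr => c _ do rewrite -mulr_suml -mulr_sumr sum_sym_sign.
  rewrite (bigD1 a)//= big1 => [|c ca]; last first.
    by rewrite eq_sym (negbTE ca) mul0r mulr0 mul0r.
  rewrite eqxx mul1r addr0.
  over.
rewrite -mulr_sumr; set S := \sum_i _.
suff -> : S = \tr L by rewrite -mulrA [LHS]mulrC.
rewrite /S /mxtrace.
have [i [j [k ->]]] := idx3P a.
rewrite sum_idx3.
rewrite -(pair_bigA _ (fun s12 s3 => L (sym_shift (s12, s3) (idx3 i j k))
  (sym_shift (s12, s3) (idx3 i j k))))/=.
rewrite -(pair_bigA _ (fun s1 s2 => \sum_s3 L (sym_shift ((s1, s2), s3) (idx3 i j k))
  (sym_shift ((s1, s2), s3) (idx3 i j k))))/=.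
rewrite /sym_shift/= coord1E coord2E coord3E.
rewrite [RHS](reindex_inj (@addrI _ i)); apply: eq_bigr => s1 _.
rewrite [RHS](reindex_inj (@addrI _ j)); apply: eq_bigr => s2 _.
by rewrite [RHS](reindex_inj (@addrI _ k)).
Qed.

(** In the average representing u there are K N terms, each of projective norm at most the Euclidean
    norm of u, and the divisor is K tr L. *)
Lemma trace_bound (p q r : \bar R) (L : 'M[R]_N) :
  (1%:E <= p)%E -> 0 < \tr L ->
  (forall u, proj_norm p q r (u *m L) <= lp_norm 2%:E u) ->
  forall u, proj_norm p q r u <= N%:R / \tr L * lp_norm 2%:E u.
Proof.
move=> p1 tL hL u; pose K : R := (2 ^+ n) ^+ 3.
have K0 : 0 < K by rewrite !exprn_gt0.
pose d := K * \tr L; have d0 : 0 < d by rewrite mulr_gt0.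
have -> : u = d^-1 *: \sum_g (u *m (sym_mx g)^T *m L *m sym_mx g).
  by rewrite average_symmetries scalerA mulVf ?scale1r// lt0r_neq0.
apply: le_trans (proj_normZ q r p1 _ _) _; rewrite gtr0_norm ?invr_gt0//.
have h : \sum_g proj_norm p q r (u *m (sym_mx g)^T *m L *m sym_mx g) <=
    K * N%:R * lp_norm 2%:E u.
  apply: (@le_trans _ _ (\sum_(g : symmetry) lp_norm 2%:E u)).
    apply: ler_sum => g _; apply: le_trans (proj_norm_sym _ _ _ _ _) _.
    by apply: le_trans (hL _) _; rewrite lp_norm_sym_tr.
  rewrite sumr_const -[_ *+ _]mulr_natl !card_prod !card_ffun card_bool !card_ord.
  by rewrite ler_wpM2r ?lp_norm_ge0// natrM ler_wpM2r// !natrM natrX /K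
    (exprS (2 ^+ n) 2) expr2 mulrA.
apply: le_trans (ler_wpM2l _ (le_trans (proj_norm_sum _ _ _ _) h)) _.
  by rewrite invr_ge0 ltW.
rewrite average_symmetries scalerA mulVf ?scale1r ?(lt0r_neq0 d0)//.
rewrite le_eqVlt; apply/orP; left; apply/eqP; rewrite /d.
by field; rewrite !lt0r_neq0.
Qed.

End symmetries.

(** * Volume of the Euclidean ball *)

Section euclidean_ball.
Context {R : realType} (N : nat).
Hypothesis N0 : (0 < N)%N.
Local Notation B2 := (unit_ball (@lp_norm R N 2%:E)).

Let N0R : 0 < N%:R :> R. Proof. by rewrite ltr0n. Qed.
Let sN0 : 0 < Num.sqrt N%:R :> R. Proof. by rewrite sqrtr_gt0. Qed.

Lemma vol_euclidean_ball_ge :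
  (((2 / Num.sqrt N%:R) ^+ N)%:E <= vol B2)%E.
Proof.
have s0 : 0 <= (Num.sqrt N%:R)^-1 :> R by rewrite invr_ge0 ltW.
rewrite -vol_cube//; apply: vol_le => x hx; rewrite /unit_ball.
by apply: le_trans (lp_norm2_le s0 hx) _; rewrite mulfV ?lt0r_neq0.
Qed.

(** The ball lies in the l_1 ball of radius sqrt N, so a single exponential centred at 0, of rate
    sqrt N and weight N, dominates it. *)
Lemma vol_euclidean_ball_le :
  (vol B2 <= ((2 * expR 1 / Num.sqrt N%:R) ^+ N)%:E)%E.
Proof.
have h := @vol_l1_mixture R N (Num.sqrt N%:R) 'I_1 (fun=> N%:R) (fun=> 0) B2 sN0.
apply: le_trans (h _) _ => [x x1|]; last first.
  rewrite big_ord1 lee_fin -[in expR N%:R](mulr1 N%:R) expRM_natl.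
  by rewrite -exprMn mulrA [expR 1 * 2]mulrC.
rewrite big_ord1 -[leLHS]expR0 ler_expR subr_ge0.
under eq_bigr do rewrite mxE subr0.
have -> : \sum_j `|x 0 j| = lp_norm 1%:E x.
  rewrite /= invr1 powRr1; last by apply: sumr_ge0 => j _; exact: powR_ge0.
  by apply: eq_bigr => j _; rewrite powRr1.
have := @lp_norm_power_mean R N 1%:E 2%:E x N0 (lexx _).
rewrite lee_fin ler1n => /(_ isT); rewrite !rexpE ?ler1n// invr1.
rewrite (_ : 1 - 2^-1 = 2^-1); last by lra.
rewrite powR12_sqrt ?ler0n// => h1.
rewrite -[leRHS](@sqr_sqrtr _ N%:R) ?ler0n// expr2 ler_pM2l//.
by apply: le_trans h1 _; rewrite ler_piMr// ltW.
Qed.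

Lemma lp_norm2_orthogonal (Q : 'M[R]_N) (u : 'rV[R]_N) : Q *m Q^T = 1%:M ->
  lp_norm 2%:E (u *m Q) = lp_norm 2%:E u.
Proof.
move=> QQ.
have E (v : 'rV[R]_N) : lp_norm 2%:E v ^+ 2 = (v *m v^T) 0 0.
  by rewrite lp_norm2_sqr mxE; apply: eq_bigr => i _; rewrite mxE expr2.
have : lp_norm 2%:E (u *m Q) ^+ 2 = lp_norm 2%:E u ^+ 2.
  apply: etrans (E _) (etrans _ (esym (E _))).
  by rewrite trmx_mul -mulmxA (mulmxA Q) QQ mul1mx.
by apply: pexpIrn; rewrite // nnegrE lp_norm_ge0.
Qed.

Lemma vol_homothetic_ball (s : R) : 0 < s ->
  vol [set 0 + u *m s%:M | u in B2] = ((s ^+ N)%:E * vol B2)%E.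
Proof.
move=> s0; rewrite vol_triangular => [|i j ij|i].
- congr (_%:E * _)%E; under eq_bigr do rewrite mxE eqxx mulr1n.
  by rewrite prodr_const card_ord.
- by rewrite mxE eq_sym -val_eqE/= (ltn_eqF ij).
- by rewrite mxE eqxx mulr1n.
Qed.

End euclidean_ball.

(** * The volume ratio in terms of the norm of the identity *)

Section volume_ratio.
Context {R : realType}.
Variables (p q r : \bar R) (n : nat).
Hypotheses (p1 : (1%:E <= p)%E) (pq : (p <= q)%E) (q2 : (q <= 2%:E)%E)
  (r2 : (2%:E <= r)%E) (n0 : (0 < n)%N).
Local Notation pn := (@proj_norm R n p q r).
Local Notation rho := (id_norm p q r n).
Local Notation C := (@volume_const R).
Local Notation N := (n * n * n)%N.
Local Notation B2 := (unit_ball (@lp_norm R N 2%:E)).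

Let q1 : (1%:E <= q)%E. Proof. exact: le_trans pq. Qed.
Let n0R : 0 < n%:R :> R. Proof. by rewrite ltr0n. Qed.
Let N0 : (0 < N)%N. Proof. by rewrite !muln_gt0 n0. Qed.
Let rho0 : 0 < rho. Proof. exact: id_norm_gt0. Qed.
Let powRn (e : R) : 0 < n%:R `^ e :> R. Proof. exact: powR_gt0. Qed.
Let powRnD (a b : R) : n%:R `^ (a + b) = n%:R `^ a * n%:R `^ b :> R.
Proof. by rewrite powRD// (lt0r_neq0 n0R) implybT. Qed.

(* Averaging the triangular factor over the symmetries of the tensor product
   turns it into the scalar [trace / N], and AM-GM compares this scalar with
   the determinant. *)
Lemma triangular_prod_le (L : 'M[R]_N) : (forall i, 0 < L i i) ->
  (forall u, pn (u *m L) <= lp_norm 2%:E u) -> \prod_i L i i <= rho^-1 ^+ N.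
Proof.
move=> Lp hL.
have trL : 0 < \tr L.
  rewrite /mxtrace (bigD1 (Ordinal N0))//= ltr_pwDl//.
  by apply: sumr_ge0 => i _; exact: ltW.
have hr : rho <= N%:R / \tr L.
  apply: id_norm_le => [|A]; first by rewrite divr_ge0// ltW.
  by move: n0 L hL {Lp} trL A; case: n => // n' _ L hL trL A; exact: trace_bound.
have [|h _] := @leif_AGM R 'I_N 'I_N (fun i => L i i); first by move=> i _; exact: ltW.
rewrite (_ : \prod_i L i i = \prod_(i in 'I_N) L i i); last exact: eq_bigl.
apply: le_trans h _.
rewrite (_ : \sum_(i in 'I_N) L i i = \tr L); last exact: eq_bigl.
have NR : 0 < N%:R :> R by rewrite ltr0n.
rewrite card_ord; apply: lerXn2r; rewrite ?nnegrE ?divr_ge0 ?invr_ge0 ?(ltW trL) ?(ltW rho0)//.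
rewrite -[leRHS]div1r ler_pdivlMr// mulrC mulrA ler_pdivrMr// mul1r.
by rewrite -ler_pdivlMr.
Qed.

(** Writing T = Q L, the orthogonal Q preserves the Euclidean ball, so the volume is governed by the
    diagonal of L. *)
Lemma vol_ellipsoid_le (E : set 'rV[R]_N) : is_ellipsoid E ->
  E `<=` unit_ball pn -> (vol E <= (rho^-1 ^+ N)%:E * vol B2)%E.
Proof.
move=> [c [T [uT ->]]] hE; have [Q [L [QQ TE L0 Lp]]] := qr_decomposition uT.
have -> : [set c + u *m T | u in B2] = [set c + u *m L | u in B2].
  have QQ' := mulmx1C QQ.
  apply/seteqP; split=> _ [u u1 <-].
    exists (u *m Q); last by rewrite TE mulmxA.
    by rewrite /unit_ball/= -[leLHS]/(lp_norm 2%:E _) lp_norm2_orthogonal.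
  exists (u *m Q^T).
    rewrite /unit_ball/= -[leLHS]/(lp_norm 2%:E _) lp_norm2_orthogonal//.
    by rewrite trmxK.
  by rewrite TE mulmxA -(mulmxA u) QQ' mulmx1.
rewrite vol_triangular//; apply: lee_wpmul2r; first exact: vol_ge0.
rewrite lee_fin; apply: triangular_prod_le => // u.
(* The centre drops out by symmetry: v T is half the difference of the two points c + v T and c - v
   T of the ball. *)
have small v : lp_norm 2%:E v <= 1 -> pn (v *m T) <= 1.
  move=> v1; have h1 : pn (c + v *m T) <= 1 by apply: hE; exists v.
  have h2 : pn (c - v *m T) <= 1.
    apply: hE; exists (- v); last by rewrite mulNmx.
    rewrite -scaleN1r /unit_ball/= -[leLHS]/(lp_norm 2%:E _).
    by rewrite lp_normZ ?lee_fin ?ler1n// normrN1 mul1r.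
  have -> : v *m T = 2^-1 *: (c + v *m T) + (- 2^-1) *: (c - v *m T).
    rewrite scaleNr scalerBr scalerDr opprB addrC addrA subrK.
    rewrite -scalerDl (_ : 2^-1 + 2^-1 = 1) ?scale1r//; lra.
  apply: le_trans (proj_normD _ _ _ _ _) _.
  apply: le_trans (lerD (proj_normZ q r p1 _ _) (proj_normZ q r p1 _ _)) _.
  rewrite normrN ger0_norm ?invr_ge0//; lra.
have {}small v : lp_norm 2%:E v <= 1 -> pn (v *m L) <= 1.
  move=> v1; have -> : v *m L = v *m Q^T *m T.
    by rewrite TE mulmxA -(mulmxA v) (mulmx1C QQ) mulmx1.
  by apply: small; rewrite lp_norm2_orthogonal ?trmxK ?(mulmx1C QQ).
have := lp_norm_ge0 2%:E u; rewrite le_eqVlt => /predU1P[/esym u0|u0].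
  have -> : u = 0 by apply: lp_norm_eq0 u0; rewrite lee_fin ler1n.
  rewrite mul0mx -(scale0r (0 : 'rV[R]_N)).
  apply: le_trans (proj_normZ q r p1 _ _) _.
  by rewrite normr0 mul0r lp_norm_ge0.
have := small ((lp_norm 2%:E u)^-1 *: u).
rewrite lp_normZ ?lee_fin ?ler1n// gtr0_norm ?invr_gt0// mulVf ?lt0r_neq0//.
move=> /(_ (lexx _)) h.
have -> : u *m L = lp_norm 2%:E u *: (((lp_norm 2%:E u)^-1 *: u) *m L).
  by rewrite -scalemxAl scalerA mulfV ?scale1r// lt0r_neq0.
apply: le_trans (proj_normZ q r p1 _ _) _.
by rewrite gtr0_norm// ler_piMr// ltW.
Qed.

Lemma is_max_vol_ellipsoid_ball :
  is_max_vol_ellipsoid (unit_ball pn) [set 0 + u *m (rho^-1)%:M | u in B2].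
Proof.
have ir0 : 0 < rho^-1 by rewrite invr_gt0.
split.
- by exists 0, (rho^-1)%:M; split => //; rewrite unitmxE det_scalar unitfE expf_neq0// lt0r_neq0.
- move=> _ [u u1 <-]; rewrite add0r mul_mx_scalar /unit_ball/=.
  apply: le_trans (proj_norm_le_id p1 pq r2 _) _.
  rewrite lp_normZ ?lee_fin ?ler1n// gtr0_norm// mulrA mulfV ?lt0r_neq0//.
  by rewrite mul1r.
- by move=> E' hE' hE; rewrite vol_homothetic_ball//; exact: vol_ellipsoid_le.
Qed.

(** [max_vol_ellipsoid] selects some maximiser, and any two maximisers have the same volume, here
    that of the Euclidean ball of radius 1/rho. *)
Lemma vol_max_ellipsoid :
  vol (max_vol_ellipsoid (unit_ball pn)) = ((rho^-1 ^+ N)%:E * vol B2)%E.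
Proof.
have ir0 : 0 < rho^-1 by rewrite invr_gt0.
have hb := is_max_vol_ellipsoid_ball.
have : is_max_vol_ellipsoid (unit_ball pn) (max_vol_ellipsoid (unit_ball pn)).
  apply: (@xgetPex _ set0 [set E | is_max_vol_ellipsoid (unit_ball pn) E]).
  by exists [set 0 + u *m (rho^-1)%:M | u in B2].
move=> [h1 h2 h3]; have [b1 b2 b3] := hb.
apply/eqP; rewrite eq_le; apply/andP; split; first exact: vol_ellipsoid_le.
by rewrite -vol_homothetic_ball//; exact: h3.
Qed.

(** The N-th roots of the volumes of the ball and of [B2] lie between 2 d and 2 C d, and between 2 /
    sqrt N and 2 e / sqrt N; moreover d sqrt N = n^(-(1/2+1/r)). *)
Lemma vr_proj_bounds :
  (expR 1)^-1 * (rho * n%:R `^ (- (2^-1 + rexp r))) <= vr_proj p q r n /\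
  vr_proj p q r n <= C * (rho * n%:R `^ (- (2^-1 + rexp r))).
Proof.
have C0 := @volume_const_gt0 R.
have e0 : 0 < expR 1 :> R by exact: expR_gt0.
have NR : 0 < N%:R :> R by rewrite ltr0n.
pose sN : R := Num.sqrt N%:R.
have sN0 : 0 < sN by rewrite sqrtr_gt0.
pose d : R := n%:R `^ (- (2 + rexp r)).
have d0 : 0 < d by exact: powRn.
have fin_between (x : \bar R) (a b : R) : (a%:E <= x)%E -> (x <= b%:E)%E ->
    a <= fine x <= b by case: x => //= x; rewrite !lee_fin => -> ->.
have /andP[V1 V2] := fin_between _ _ _ (vol_ball_ge p1 pq r2 n0)
  (vol_ball_le p1 pq q2 r2 n0).
have /andP[W1 W2] := fin_between _ _ _ (vol_euclidean_ball_ge N0)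
  (vol_euclidean_ball_le N0).
rewrite -/sN -/d in V1 V2 W1 W2.
have Wfin : vol B2 \is a fin_num.
  rewrite ge0_fin_numE ?vol_ge0//.
  exact: le_lt_trans (vol_euclidean_ball_le N0) (ltry _).
rewrite /vr_proj /volume_ratio vol_max_ellipsoid fineM//=.
set V := fine (vol (unit_ball pn)) in V1 V2 *.
set W := fine (vol B2) in W1 W2 *.
have W0 : 0 < W by apply: lt_le_trans W1; rewrite exprn_gt0// divr_gt0.
have V0 : 0 < V by apply: lt_le_trans V1; rewrite exprn_gt0// mulr_gt0.
have ir0 : 0 < rho^-1 ^+ N by rewrite exprn_gt0// invr_gt0.
have dE : d = n%:R `^ (- (2^-1 + rexp r)) / sN.
  rewrite /sN -powR12_sqrt ?ler0n// -powRN /d.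
  rewrite (_ : N%:R = n%:R `^ 3 :> R); last first.
    by rewrite powR_mulrn ?ler0n// !natrM exprS expr2 mulrA.
  rewrite -powRrM -powRnD; congr (_ `^ _); lra.
have rootE (x : R) : 0 <= x -> (x ^+ N) `^ (N%:R)^-1 = x.
  by move=> x0; rewrite -powR_mulrn// -powRrM mulfV ?powRr1// lt0r_neq0.
set b := n%:R `^ (- (2^-1 + rexp r)) in dE *.
have b0 : 0 < b by exact: powRn.
have mono (x y : R) : 0 <= x -> x <= y -> x `^ (N%:R)^-1 <= y `^ (N%:R)^-1.
  move=> x0 xy; apply: ge0_ler_powR; rewrite ?nnegrE ?invr_ge0 ?ler0n//.
  exact: le_trans xy.
split.
- rewrite -[leLHS]rootE; last by rewrite !mulr_ge0 ?invr_ge0 ?(ltW e0) ?(ltW rho0) ?(ltW b0).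
  apply: mono; first by rewrite exprn_ge0// !mulr_ge0 ?invr_ge0 ?(ltW e0) ?(ltW rho0) ?(ltW b0).
  rewrite ler_pdivlMr ?mulr_gt0//; apply: le_trans V1.
  apply: (@le_trans _ _ (((expR 1)^-1 * (rho * b)) ^+ N *
    (rho^-1 ^+ N * (2 * expR 1 / sN) ^+ N))).
    by rewrite !ler_wpM2l ?(ltW ir0)// exprn_ge0// !mulr_ge0
      ?invr_ge0 ?(ltW e0) ?(ltW rho0) ?(ltW b0).
  rewrite -!exprMn dE le_eqVlt; apply/orP; left; apply/eqP; congr (_ ^+ _).
  by field; rewrite !lt0r_neq0.
- rewrite -[leRHS]rootE; last by rewrite !mulr_ge0 ?(ltW C0) ?(ltW rho0) ?(ltW b0).
  apply: mono; first by rewrite divr_ge0 ?mulr_ge0 ?(ltW V0) ?(ltW W0) ?(ltW ir0).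
  rewrite ler_pdivrMr ?mulr_gt0//; apply: le_trans V2 _.
  apply: (@le_trans _ _ ((C * (rho * b)) ^+ N * (rho^-1 ^+ N * (2 / sN) ^+ N))); last first.
    by rewrite !ler_wpM2l ?(ltW ir0)// exprn_ge0// !mulr_ge0 ?(ltW C0) ?(ltW rho0) ?(ltW b0).
  rewrite -!exprMn dE le_eqVlt; apply/orP; left; apply/eqP; congr (_ ^+ _).
  by field; rewrite !lt0r_neq0.
Qed.

End volume_ratio.

(** * From bounds for each n to asymptotic equivalence *)

Section asymptotics.
Context {R : realType} (p q r : \bar R).
Hypotheses (p1 : (1%:E <= p)%E) (pq : (p <= q)%E) (q2 : (q <= 2%:E)%E)
  (r2 : (2%:E <= r)%E).

Lemma asymp_id_norm (e c : R) : 0 < c ->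
  (forall n, (0 < n)%N -> n%:R `^ e <= c * id_norm p q r n) ->
  e = Num.min (rexp q + rexp r) 1 ->
  asymp (id_norm p q r) (fun n => n%:R `^ e).
Proof.
move=> c0 h eE; exists c^-1, 1; split => [||n n0]; rewrite ?invr_gt0// mul1r.
split; first by rewrite mulrC ler_pdivrMr// mulrC; exact: h.
by rewrite eE; exact: id_norm_upper.
Qed.

Lemma asymp_vr_proj (e e' : R) : e' = e - (2^-1 + rexp r) ->
  asymp (id_norm p q r) (fun n => n%:R `^ e) ->
  asymp (vr_proj p q r) (fun n => n%:R `^ e').
Proof.
move=> eE [c [C [c0 C0 h]]].
have vr n := @vr_proj_bounds R p q r n p1 pq q2 r2.
move: (@volume_const R) (@volume_const_gt0 R) vr => V V0 vr.
have e0 : 0 < expR 1 :> R by exact: expR_gt0.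
exists ((expR 1)^-1 * c), (V * C); split => [||n n0].
- by rewrite mulr_gt0// invr_gt0.
- by rewrite mulr_gt0.
have nR : 0 < n%:R :> R by rewrite ltr0n.
have [h1 h2] := h n n0; have [v1 v2] := vr n n0.
rewrite eE powRD ?(lt0r_neq0 nR) ?implybT//.
split; [apply: le_trans v1|apply: le_trans v2 _]; rewrite -!mulrA.
  by rewrite ler_wpM2l ?invr_ge0 ?(ltW e0)// mulrA ler_wpM2r ?powR_ge0.
by rewrite ler_wpM2l ?(ltW V0)// [leRHS]mulrA ler_wpM2r ?powR_ge0.
Qed.

End asymptotics.

Theorem corollary5p7 (R : realType) (p q r : \bar R)
    (hp : (1%:E <= p)%E) (hpq : (p <= q)%E) (hqr : (q <= r)%E) :
  (p = 1%:E -> (q <= 2%:E)%E -> (2%:E <= r)%E ->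
     asymp (id_norm p q r)
       (fun n => n%:R `^ Num.min (rexp q + rexp r) 1) /\
     asymp (vr_proj p q r)
       (fun n => n%:R `^ Num.min (rexp q - 2^-1) (2^-1 - rexp r)))
  /\
  (p = q -> (q <= 2%:E)%E -> r = +oo%E ->
     asymp (id_norm p q r) (fun n => n%:R `^ rexp q) /\
     asymp (vr_proj p q r) (fun n => n%:R `^ (rexp q - 2^-1)))
  /\
  (q = 2%:E ->
     asymp (id_norm p q r) (fun n => n%:R `^ (2^-1 + rexp r)) /\
     asymp (vr_proj p q r) (fun=> 1)).
Proof.
have V0 := @volume_const_gt0 R.
have q1 : (1%:E <= q)%E by exact: le_trans hpq.
split; [|split].
- move=> pE q2 r2.
  have h : asymp (id_norm p q r) (fun n => n%:R `^ Num.min (rexp q + rexp r) 1).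
    apply: (asymp_id_norm hp hpq q2 r2 ltr01) => // n n0.
    by rewrite mul1r; exact: id_norm_ge_diagonal.
  split => //; apply: asymp_vr_proj h => //.
  by case: (leP (rexp q + rexp r) 1) => h1; [rewrite min_l|rewrite min_r]; lra.
- move=> _ q2 rE.
  have r2 : (2%:E <= r)%E by rewrite rE leey.
  have h : asymp (id_norm p q r) (fun n => n%:R `^ rexp q).
    apply: (asymp_id_norm hp hpq q2 r2 V0) => [n n0|].
      exact: id_norm_ge_slice.
    by rewrite rE rexp_oo addr0 min_l// rexp_le1.
  split => //; apply: asymp_vr_proj h => //.
  by rewrite rE rexp_oo addr0.
- move=> qE.
  have q2 : (q <= 2%:E)%E by rewrite qE.
  have r2 : (2%:E <= r)%E by rewrite -qE.
  have rq : rexp q = 2^-1 by rewrite qE rexpE// ler1n.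
  have rr : rexp r <= 2^-1 by rewrite -rq; exact: rexp_antitone.
  have h : asymp (id_norm p q r) (fun n => n%:R `^ (2^-1 + rexp r)).
    apply: (asymp_id_norm hp hpq q2 r2 V0) => [n n0|].
      exact: id_norm_ge_volume.
    by rewrite rq min_l//; lra.
  split => //.
  have -> : (fun=> 1) = (fun n : nat => n%:R `^ 0) :> (nat -> R).
    by apply/funext => n; rewrite powRr0.
  by apply: asymp_vr_proj h => //; rewrite subrr.
Qed.
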